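(* The number of irreducible constituents of the Weil module $X$ is equal to the number of orbits of $U$ acting on $V$. This common number is: $\bullet$ $q^\ell$ if $m=1$; $\bullet$ $2q^{\ell}-1$ if $m=2$ and $h$ is of type $\{1,-\epsilon\}$; $\bullet$ $2(q^{\ell}+q^{\ell-1}+\cdots+q)+1$ if $m>2$, or $m=2$ and $h$ is of type $\{1,-1\}$.
   Context: Setting. $R$ is a finite commutative local principal ring of odd prime characteristic $p$, with maximal ideal $\mathfrak m$ of nilpotency degree $\ell\ge 1$ and residue field $R/\mathfrak m\cong F_q$. Let $x$ be a generator of $\mathfrak m$ and $A=R[t]/(t^2-x)=R\oplus Ry$, $y^2=x$ (ramified quadratic extension of $R$), with involution $(r+sy)^*=r-sy$ ($r,s\in R$). $A$ is a finite local principal ring with maximal ideal $\mathfrak r=Ay$ of nilpotency degree $2\ell$ and residue field $F_q$. Put $\mathfrak i=\mathfrak r^\ell=Ay^\ell$. $V$ is a free $A$-module of finite rank $m\ge 1$ and $h:V\times V\to A$ is a non-degenerate hermitian form: $h$ is bi-additive, $A$-linear in the second variable, $h(v,u)=h(u,v)^*$, and $v\mapsto h(v,-)$ is a bijection $V\to \mathrm{Hom}_A(V,A)$. $U=\{g\in \mathrm{GL}_A(V): h(gu,gv)=h(u,v)\ \forall u,v\in V\}$. Let $d:A\to R$, $d(r+sy)=2s$. Fix a primitive linear character $\lambda:R^+\to\mathbf C^\times$ (its kernel contains no non-zero ideal of $R$) and put $\mu=\lambda\circ d:A^+\to\mathbf C^\times$. Weil module. Let $T$ be a transversal for $\mathfrak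 iV$ in $V$. The Weil module $X$ (of type $\mu$) is the complex $U$-module with basis $\{e_v: v\in T\}$ and action $ge_v=\mu(h(gv,v'))e_{v'}$ for $g\in U$, $v,v'\in T$, $gv\equiv v' \bmod \mathfrak iV$. ($X$ is multiplicity free.) Types. $\epsilon$ is a fixed element of $R^\times$ that is not a square in $R^\times$. For $r_1,\dots,r_m\in R^\times$, $h$ is of type $\{r_1,\dots,r_m\}$ if $V$ has a basis relative to which $h$ has matrix $\mathrm{diag}(r_1,\dots,r_m)$. (For $m=2$, $h$ is of exactly one of the types $\{1,-1\}$, $\{1,-\epsilon\}$.) *)

(* Defs.v *)
From HB Require Import structures.
From mathcomp Require Import all_boot all_order all_algebra all_fingroup.
From mathcomp Require Import mxrepresentation.
From mathcomp Require Import reals.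
From mathcomp Require Import complex.

Set Implicit Arguments.
Unset Strict Implicit.
Unset Printing Implicit Defensive.

Import GRing.Theory.
Local Open Scope ring_scope.

Section Ideals.
Variable R : finComNzRingType.
Implicit Types (I J m : {set R}).

(* Not ssralg's [idealr_closed], which only covers proper ideals. *)
Definition is_ideal I : Prop :=
  0 \in I /\ forall a, {in I &, forall u v, a * u + v \in I}.

Definition is_maximal_ideal I : Prop :=
  [/\ is_ideal I, I != setT &
      forall J, is_ideal J -> I \subset J -> J = I \/ J = setT].

Definition is_local_with m : Prop :=
  is_maximal_ideal m /\ forall J, is_maximal_ideal J -> J = m.

Definition principal_ideal (a : R) : {set R} := [set r * a | r : R].

Definition is_principal_ring : Prop :=
  forall I, is_ideal I -> exists a, I = principal_ideal a.

(* m ^ k is generated by the k-fold products of elements of m. *)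
Definition ideal_exp_eq0 m k : Prop :=
  forall f : 'I_k -> R, (forall i, f i \in m) -> \prod_i f i = 0.

Definition nilpotency_degree m l : Prop :=
  ideal_exp_eq0 m l /\ forall k, (k < l)%N -> ~ ideal_exp_eq0 m k.

End Ideals.

(* A homomorphism from the additive group of R to the units of C. *)
Definition linear_char (R : zmodType) (C : fieldType) (lam : R -> C) : Prop :=
  (forall a, lam a != 0) /\ (forall a b, lam (a + b) = lam a * lam b).

Definition is_primitive (R : finComNzRingType) (C : fieldType)
    (lam : R -> C) : Prop :=
  forall I : {set R}, is_ideal I -> {in I, forall a, lam a = 1} -> I = [set 0].

(* A = R[t]/(t^2 - x); the class y of t is [ramified_y x], and an element of A is stored
   as its reduced representative, so a = a`_0 + a`_1 y (lemma ramifiedE). *)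
Notation ramified x := {poly %/ ('X^2 - x%:P)}.
Notation ramified_y x := (qpolyX ('X^2 - x%:P)).

Section RamifiedExtension.
Variables (R : finComUnitRingType) (x : R).
Local Notation A := (ramified x).
Local Notation y := (ramified_y x).
Implicit Types a b : A.

Definition star a : A := (a`_0)%:A - a`_1 *: y.

Definition dmap a : R := a`_1 *+ 2.

Lemma monic_h : ('X^2 - x%:P) \is monic.
Proof. by rewrite monicXnsubC. Qed.

Lemma size_h : size ('X^2 - x%:P) = 3%N.
Proof. by rewrite size_XnsubC. Qed.

Lemma mkm : mk_monic ('X^2 - x%:P) = 'X^2 - x%:P.
Proof. by rewrite /mk_monic size_h monic_h. Qed.

Lemma qXE : y = 'X :> {poly R}.
Proof. by apply: qpolyXE; rewrite ?size_h ?monic_h. Qed.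

Lemma coef_pair (r s : R) :
  ((r%:A + s *: y : A)`_0 = r) * ((r%:A + s *: y : A)`_1 = s).
Proof.
have -> : (r%:A + s *: y : A) = r%:P + s *: 'X :> {poly R}.
  by rewrite poly_of_qpolyD !poly_of_qpolyZ qXE -mul_polyC mulr1.
by rewrite !coefD !coefZ !coefX !coefC /= !mulr1 mulr0 addr0 add0r.
Qed.

Lemma ramifiedE a : a = (a`_0)%:A + a`_1 *: y.
Proof.
have [r0 r1] := coef_pair (a`_0) (a`_1).
apply/npolyP => -[|[|i]]; [by rewrite r0 | by rewrite r1 |].
by rewrite !big_coef_npoly // mkm size_h.
Qed.

Lemma qX_sqr : y * y = x%:A :> A.
Proof.
apply: val_inj; rewrite [LHS]poly_of_qpolyM [RHS]poly_of_qpolyZ qXE.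
change (polyn (1 : A)) with (1%:P : {poly R}); rewrite mkm.
have -> : 'X * 'X = 1 * ('X^2 - x%:P) + x%:P :> {poly R}.
  by rewrite mul1r subrK expr2.
rewrite Pdiv.RingMonic.rmodpD ?monic_h // Pdiv.RingMonic.rmodp_mull ?monic_h //.
rewrite add0r Pdiv.Ring.rmodp_small ?size_h; last exact: leq_trans (size_polyC_leq1 _) _.
by rewrite /= -mul_polyC mulr1.
Qed.

Lemma starE (r s : R) : star (r%:A + s *: y) = r%:A - s *: y.
Proof. by rewrite /star !coef_pair. Qed.

Lemma dmapE (r s : R) : dmap (r%:A + s *: y) = s *+ 2.
Proof. by rewrite /dmap !coef_pair. Qed.

Lemma dmapD a b : dmap (a + b) = dmap a + dmap b.
Proof. by rewrite /dmap /= coefD mulrnDl. Qed.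

Lemma dmap0 : dmap 0 = 0.
Proof. by rewrite /dmap /= coef0 mul0rn. Qed.

Lemma dmapB a b : dmap (a - b) = dmap a - dmap b.
Proof. by apply/(canRL (addrK _)); rewrite -dmapD subrK. Qed.

Lemma dmap_star a : star a = a -> dmap a = 0.
Proof.
move=> e; have := congr1 (fun b : A => b`_1) e.
rewrite {1}(ramifiedE a) starE -scaleNr coef_pair => {}e.
by rewrite /dmap mulr2n -{1}e addNr.
Qed.

Lemma starM a b : star (a * b) = star a * star b.
Proof.
have mulE (r s r' s' : R) : (r%:A + s *: y) * (r'%:A + s' *: y) =
   (r * r' + s * s' * x)%:A + (r * s' + s * r') *: y :> A.
  rewrite mulrDl !mulrDr -!scalerAl -!scalerAr !mul1r mulr1 qX_sqr !scalerA.
  rewrite !scalerDl.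
  by rewrite addrA [RHS]addrAC -!addrA.
rewrite [in LHS](ramifiedE a) [in LHS](ramifiedE b) mulE starE {1}/star {1}/star -!scaleNr mulE.
by rewrite !mulrNN !mulrN !mulNr opprD.
Qed.

Lemma star_qX : star y = - y.
Proof. by rewrite -[X in star X]scale1r -[X in star X]add0r -(scale0r 1) starE scale1r scale0r add0r. Qed.

Lemma star_qXn l : star (y ^+ l) = (- y) ^+ l.
Proof.
elim: l => [|l IH]; first by have := starE 1 0; rewrite !scale0r subr0 addr0 scale1r.
by rewrite [y ^+ _](exprS y) [RHS](exprS (- y)) starM IH star_qX.
Qed.

Lemma qXn_eq0 l : x ^+ l = 0 -> y ^+ l * y ^+ l = 0 :> A.
Proof.
by move=> xl; rewrite -exprMn qX_sqr exprZn xl scale0r.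
Qed.

End RamifiedExtension.

Section HermitianForms.
Variables (R : finComUnitRingType) (x : R).
Local Notation A := (ramified x).
Local Notation y := (ramified_y x).
Variable V : finLmodType A.
Implicit Types (h : V -> V -> A) (T : {set V}).

Definition is_basis n (b : 'I_n -> V) : Prop :=
  forall v, exists! c : {ffun 'I_n -> A}, v = \sum_i c i *: b i.

Definition free_of_rank n : Prop := exists b : 'I_n -> V, is_basis b.

(* Linear in the second variable, whereas sesquilinear.v has the first one. *)
Definition is_hermitian h : Prop :=
  [/\ forall u u' v, h (u + u') v = h u v + h u' v,
      forall u v v', h u (v + v') = h u v + h u v',
      forall a u v, h u (a *: v) = a * h u v &
      forall u v, h v u = star (h u v)].

Definition is_nondegenerate h : Prop :=
  forall f : {scalar V}, exists! v, h v =1 f.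

Definition of_type h n (r : n.-tuple R) : Prop :=
  exists b : 'I_n -> V, is_basis b /\
    forall i j, h (b i) (b j) = if i == j then (tnth r i)%:A else 0.

Definition unitary_set h : {set {perm V}} :=
  [set g : {perm V} |
    [&& [forall u, forall v, g (u + v) == g u + g v],
        [forall a : A, forall v, g (a *: v) == a *: g v] &
        [forall u, forall v, h (g u) (g v) == h u v]]].

Lemma unitaryP h (g : {perm V}) :
  reflect [/\ forall u v, g (u + v) = g u + g v,
              forall (a : A) v, g (a *: v) = a *: g v &
              forall u v, h (g u) (g v) = h u v]
          (g \in unitary_set h).
Proof.
rewrite inE; apply: (iffP and3P) => -[g1 g2 g3]; split.
- by move=> u v; move/forallP: g1 => /(_ u)/forallP/(_ v)/eqP.
- by move=> u v; move/forallP: g2 => /(_ u)/forallP/(_ v)/eqP.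
- by move=> u v; move/forallP: g3 => /(_ u)/forallP/(_ v)/eqP.
- by apply/forallP => u; apply/forallP => v; rewrite g1.
- by apply/forallP => u; apply/forallP => v; rewrite g2.
- by apply/forallP => u; apply/forallP => v; rewrite g3.
Qed.

Lemma unitary_group_set h : group_set (unitary_set h).
Proof.
apply/group_setP; split; first by apply/unitaryP; split=> *; rewrite !perm1.
move=> f g /unitaryP[f1 f2 f3] /unitaryP[g1 g2 g3]; apply/unitaryP.
by split=> *; rewrite !permM ?f1 ?g1 ?f2 ?g2 ?g3 ?f3.
Qed.

Canonical unitary_group h : {group {perm V}} := Group (unitary_group_set h).

Definition ideal_i l : {set A} := [set c * y ^+ l | c : A].

(* The products a v with a in the ideal i; they already form a submodule,
   because i is principal (lemma iVP). *)
Definition iV l : {set V} :=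
  [set a *: v | a : A in ideal_i l, v : V].

Definition is_transversal_mod l T : Prop :=
  forall v, exists! t, t \in T /\ v - t \in iV l.

Definition num_unitary_orbits h : nat :=
  #|orbit 'P (unitary_group h) @: [set: V]|.

(* Row i is the image of the i-th basis vector: with row vectors e_v, this is
   e_v *m weil_mx g = mu (h (g v) v') e_v'. Permutations compose as
   (f * g) v = g (f v), which is the order in which matrices act on rows, so
   row-stable subspaces are exactly the U-submodules of X. *)
Definition weil_mx l h (C : fieldType) (lam : R -> C) T (g : {perm V}) :
    'M[C]_#|T| :=
  \matrix_(i, j)
    let v : V := enum_val i in let v' : V := enum_val j in
    if g v - v' \in iV l then lam (dmap (h (g v) v')) else 0.

Lemma iVP l (v : V) : reflect (exists w, v = y ^+ l *: w) (v \in iV l).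
Proof.
apply: (iffP imset2P) => [[a w /imsetP[r _ ->] _ ->]|[w ->]].
  by exists (r *: w); rewrite mulrC scalerA.
by exists (y ^+ l) w => //; apply/imsetP; exists 1; rewrite ?mul1r.
Qed.

Lemma generator_expn (m : {set R}) l :
  m = principal_ideal x -> nilpotency_degree m l -> x ^+ l = 0.
Proof.
move=> -> [/(_ (fun=> x)) H _]; rewrite -{}H ?prodr_const ?card_ord // => _.
by apply/imsetP; exists 1; rewrite ?mul1r.
Qed.

Lemma weil_mx_repr (m : {set R}) l h (C : fieldType) (lam : R -> C) T :
  m = principal_ideal x -> nilpotency_degree m l ->
  is_hermitian h -> linear_char lam -> is_transversal_mod l T ->
  mx_repr (unitary_group h) (weil_mx l h lam T).
Proof.
move=> mx ml [hDl hDr hZr hS] [lam0 lamD] Ttr.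
have yl := qXn_eq0 (generator_expn mx ml).
have lam_0 : lam 0 = 1.
  by apply: (mulfI (lam0 0)); rewrite mulr1 -lamD addr0.
have iVD v w : v \in iV l -> w \in iV l -> v + w \in iV l.
  move=> /iVP[v' ->] /iVP[w' ->]; apply/iVP; exists (v' + w').
  by rewrite scalerDr.
have iVN v : v \in iV l -> - v \in iV l.
  by move=> /iVP[v' ->]; apply/iVP; exists (- v'); rewrite scalerN.
have iV0 : 0 \in iV l by apply/iVP; exists 0; rewrite scaler0.
have Tinj (i j : 'I_#|T|) (v : V) :
    v - enum_val i \in iV l -> v - enum_val j \in iV l -> i = j.
  move=> vi vj; have [t [_ tU]] := Ttr v; apply: enum_val_inj.
  have Ui := tU (enum_val i) (conj (enum_valP i) vi).
  have Uj := tU (enum_val j) (conj (enum_valP j) vj).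
  exact: etrans (esym Ui) Uj.
have hZl a u v : h (a *: u) v = star a * h u v.
  by rewrite hS hZr starM -hS.
have hii v w : v \in iV l -> w \in iV l -> h v w = 0.
  move=> /iVP[v' ->] /iVP[w' ->]; rewrite hZl hZr star_qXn (exprNn y).
  move: (y ^+ l) yl ((-1) ^+ l) (h v' w') => z zz c b.
  by rewrite -(mulrA c) (mulrA z) zz mul0r mulr0.
have hBl u u' v : h (u - u') v = h u v - h u' v.
  by apply/(canRL (addrK _)); rewrite -hDl subrK.
have dh v : dmap (h v v) = 0 by apply: dmap_star; rewrite -hS.
split=> [|f g /unitaryP[f1 f2 f3] /unitaryP[g1 g2 g3]]; apply/matrixP => i k.
  rewrite !mxE /= !perm1; case: eqVneq => [->|ne]; first by rewrite subrr iV0 dh lam_0.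
  case: ifP => // Hi; case/eqP: ne; apply: (Tinj i k (enum_val i)) => //.
  by rewrite subrr.
rewrite !mxE /= !permM.
have [t [[tT ft] _]] := Ttr (f (enum_val i)).
set v := enum_val i in ft *; set w := enum_val k.
have tj : enum_val (enum_rank_in tT t) = t by rewrite enum_rankK_in.
rewrite (bigD1 (enum_rank_in tT t)) //= big1 ?addr0 => [|j nj]; last first.
  rewrite !mxE /=; case: ifP => [fj|_]; last by rewrite mul0r.
  by case/eqP: nj; apply: (Tinj j _ _ fj); rewrite tj.
rewrite !mxE /= tj -/v -/w ft.
have gB u u' : g (u - u') = g u - g u'.
  by apply/(canRL (addrK _)); rewrite -g1 subrK.
have gft : g (f v) - g t \in iV l.
  by rewrite -gB; case/iVP: ft => z ->; apply/iVP; exists (g z); rewrite g2.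
have -> : (g (f v) - w \in iV l) = (g t - w \in iV l).
  apply/idP/idP => H.
    by have := iVD _ _ (iVN _ gft) H; rewrite opprB addrA subrK.
  by have := iVD _ _ gft H; rewrite addrA subrK.
case: ifP => gw; last by rewrite mulr0.
rewrite -lamD; congr lam.
have hBr u u' z : h z (u - u') = h z u - h z u'.
  by apply/(canRL (addrK _)); rewrite -hDr subrK.
have := hii _ _ gft gw; rewrite hBr !hBl !g3.
move/(congr1 (@dmap _ _)); rewrite !dmapB dh dmap0 subr0 => /eqP.
by rewrite subr_eq0 => /eqP ->; rewrite subrK.
Qed.

Definition weil_repr (m : {set R}) l h (C : fieldType) (lam : R -> C) T
    (mx : m = principal_ideal x) (ml : nilpotency_degree m l)
    (hh : is_hermitian h) (hlam : linear_char lam)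
    (hT : is_transversal_mod l T) : mx_representation C (unitary_group h) #|T| :=
  MxRepresentation (weil_mx_repr mx ml hh hlam hT).

End HermitianForms.

(* Number of isomorphism types of simple submodules, i.e. of homogeneous
   components of the socle; in characteristic 0 the socle is the whole module. *)
Definition num_irr_constituents (F : decFieldType) (gT : finGroupType)
    (G : {group gT}) n (rG : mx_representation F G n) : nat :=
  #|DecSocleType rG|.

(* Main.v *)
Require Import Defs.
From HB Require Import structures.
From mathcomp Require Import all_boot all_order all_algebra all_fingroup.
From mathcomp Require Import pgroup mxrepresentation.
From mathcomp Require Import reals.
From mathcomp Require Import complex.
From mathcomp Require Import ring zify.

Set Implicit Arguments.
Unset Strict Implicit.
Unset Printing Implicit Defensive.

Import GRing.Theory.
Local Open Scope ring_scope.

(* The matrices heis u (u in V), acting on X as the Schroedinger operators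
   e_v |-> mu (h u v) e_(u + v), form a basis of End X permuted by conjugation under U; hence
   the commutant of U has the U-orbit sums as a basis. An orthogonal basis of V yields a
   semilinear map s with h (s u) (s v) = h v u; it preserves every U-orbit, so it induces an
   anti-automorphism of End X fixing all orbit sums. The commutant is therefore commutative, X
   is multiplicity free and its constituents are equinumerous with the orbits.

   Every vector is y^i w with w primitive and i <= 2l. Witt's theorem for primitive vectors
   (via quasi-reflections) and a Hensel argument show that, for i < 2l, the orbit of y^i w is
   determined by i and x^(i/2) h (w, w). If S is the set of norms of primitive vectors, the
   number of orbits is thus 2 (sum_(j < l) |x^j S|) + 1, and S is the set of all elements of R,
   of all units, or of all n0 u^2 with u a unit, according to the case. *)

(** * Multiplicity-free representations *)

(** Commutativity is Gelfand's trick: an anti-automorphism that fixes the commutant pointwise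
    reverses its products. The map s has to be semilinear, because reversing products requires mu (h
    u v) to be replaced by mu (h v u), its inverse. The operators [heis u] are independent because
    their traces vanish for u <> 0, which rests on 2 being invertible; they span because dim End X
    is at most |V|. On the counting side, y^i w determines w only modulo y^(2l - i) V, hence its
    norm only modulo x^(l - j) with j = i/2 rounded down; multiplication by x^j keeps just this
    information. The exponents 2j and 2j + 1 have the same precision, whence the factor 2, and the
    summand 1 is the zero vector. The obstacle in Witt's theorem is that a quasi-reflection taking u
    to w needs h (w - u, u) to be a unit. Passing to -w secures this when the norm is a unit;
    otherwise a third vector of the same norm may have to be inserted. *)

Lemma eigenvector_stable (C : closedFieldType) n (U f : 'M[C]_n) :
  U != 0 -> (U *m f <= U)%MS ->
  exists a (v : 'rV_n), [/\ v != 0, (v <= U)%MS & v *m f = a *: v].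
Proof.
(* [g] is the matrix, in the basis [B], of the restriction of [f] to the stable subspace. *)
move=> U0 Uf; pose B := row_base U; pose g := B *m f *m pinvmx B.
have sBf : (B *m f <= B)%MS.
  by rewrite (eqmxMr f (eq_row_base U)) eq_row_base.
have [|a] := closed_rootP (char_poly g) _.
  by rewrite size_char_poly eqSS mxrank_eq0.
rewrite -eigenvalue_root_char => /eigenvalueP[v vg v0].
exists a, (v *m B); split.
- apply: contra v0 => /eqP vB; apply/eqP/(row_free_inj (row_base_free U)).
  by rewrite mul0mx.
- by rewrite (submx_trans (submxMl _ _)) ?eq_row_base.
- by rewrite -mulmxA -[B *m f](mulmxKpV sBf) mulmxA vg scalemxAl.
Qed.

Section CommutantDimension.
Variables (C : closedFieldType) (gT : finGroupType) (G : {group gT}) (n : nat).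
Variable rG : mx_representation C G n.
Hypothesis char_ok : ([pchar C]^'.-group G)%g.
Local Notation sG := (DecSocleType rG).

Lemma proj_mx_centgmx (U W : 'M[C]_n) :
  mxmodule rG U -> mxmodule rG W -> (U + W :=: 1%:M)%MS -> mxdirect (U + W) ->
  centgmx rG (proj_mx U W).
Proof.
move=> mU mW UW dx; rewrite -row_full_dom_hom -sub1mx -UW.
by apply: proj_mx_hom => //; apply/mxdirect_addsP.
Qed.

Section Commutative.
Hypothesis cent_comm :
  forall f g, centgmx rG f -> centgmx rG g -> f *m g = g *m f.

(* Commuting with a projection onto a simple module M forces f to preserve M, hence to act on
   it as a scalar; commuting with the isomorphisms M -> M' forces that scalar to be the same
   for all M' in the component. *)
Lemma component_scalar (f : 'M[C]_n) (W : sG) :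
  centgmx rG f -> exists a, W *m f == a *: (W : 'M_n).
Proof.
move=> cf; set M := socle_base W; have simM : mxsimple rG M := socle_simple W.
have [modM M0 minM] := simM.
have [N modN MN dxMN] := mx_Maschke_pchar rG char_ok modM (submx1 M).
have [P [cP MP PM]] : exists P, [/\ centgmx rG P, M *m P = M & (P <= M)%MS].
  exists (proj_mx M N); split; first exact: proj_mx_centgmx.
    by apply: proj_mx_id; first exact/mxdirect_addsP.
  by rewrite -[proj_mx M N]mul1mx proj_mx_sub.
have Mf : (M *m f <= M)%MS.
  by rewrite -[in X in (X <= _)%MS]MP -mulmxA -(cent_comm cf cP) mulmxA mulmx_sub.
have [a [v [v0 vM vf]]] := eigenvector_stable M0 Mf.
have MK : (M <= kermx (f - a%:M))%MS.
  have /minM : mxmodule rG (M :&: kermx (f - a%:M))%MS.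
    rewrite capmx_module // kermx_centg_module //; apply/centgmxP => g Gg.
    by rewrite mulmxBl mulmxBr (centgmxP cf) // scalar_mxC.
  rewrite capmxSl sub_capmx submx_refl /=; apply=> //.
  apply: contra v0 => /eqP MK0; rewrite -submx0 -MK0 sub_capmx vM.
  by apply/sub_kermxP; rewrite mulmxBr vf mul_mx_scalar subrr.
have {}MK : M *m f = a *: M.
  by apply/eqP; rewrite -subr_eq0 -mul_mx_scalar -mulmxBr; apply/eqP/sub_kermxP.
exists a; rewrite -subr_eq0 -mul_mx_scalar -mulmxBr; apply/eqP/sub_kermxP.
have [I [W_ isoW defW]] := component_mx_def simM.
rewrite [socle_val W]defW.
apply/sumsmx_subP => i _; have [phi _ homphi <-] := isoW i.
have cPp : centgmx rG (P *m phi).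
  apply/centgmxP => g Gg.
  by rewrite -(hom_mxP (submx_trans PM homphi)) // (centgmxP cP g Gg) mulmxA.
apply/sub_kermxP; rewrite -{1}MP -!mulmxA [P *m _]mulmxA mulmxBr -(cent_comm cf cPp).
rewrite scalar_mxC -mulmxBl mulmxA mulmxBr MK mul_mx_scalar subrr.
by rewrite mul0mx.
Qed.

End Commutative.

(** The scalars by which the [E i] act on the homogeneous components form a matrix [L]. Its rows are
    independent, since an element of the commutant that vanishes on all components is zero. They
    span, since the projection onto a component along the others lies in the commutant. Hence [L] is
    square. *)
Lemma num_irr_constituents_commutant (I : finType) (E : I -> 'M[C]_n) :
    (forall i, centgmx rG (E i)) ->
    (forall i j, E i *m E j = E j *m E i) ->
    (forall c : I -> C, \sum_i c i *: E i = 0 -> forall i, c i = 0) ->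
    (forall f, centgmx rG f -> exists c : I -> C, f = \sum_i c i *: E i) ->
  num_irr_constituents rG = #|I|.
Proof.
move=> cE EC Efree Espan.
have cent_comm f g : centgmx rG f -> centgmx rG g -> f *m g = g *m f.
  move=> /Espan[c ->] /Espan[d ->]; rewrite mulmx_suml [RHS]mulmx_sumr.
  apply: eq_bigr => i _; rewrite mulmx_suml mulmx_sumr; apply: eq_bigr => j _.
  by rewrite -!scalemxAl -!scalemxAr EC !scalerA mulrC.
pose lam i (W : sG) := xchoose (component_scalar cent_comm W (cE i)).
have lamP i (W : sG) : W *m E i = lam i W *: (W : 'M_n).
  exact: eqP (xchooseP (component_scalar cent_comm W (cE i))).
have Socle1 : Socle sG = 1%:M by apply/reducible_Socle1/mx_Maschke_pchar.
have W0 (W : sG) : (W : 'M_n) != 0.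
  rewrite -submx0; have [_ b0 _] := socle_simple W.
  by apply: contra b0; rewrite -submx0; apply/submx_trans/component_mx_id/socle_simple.
have sumE (c : I -> C) (W : sG) :
    W *m (\sum_i c i *: E i) = (\sum_i c i * lam i W) *: (W : 'M_n).
  rewrite mulmx_sumr scaler_suml; apply: eq_bigr => i _.
  by rewrite -scalemxAr lamP scalerA.
pose L := \matrix_(i < #|I|, j < #|sG|) lam (enum_val i) (enum_val j).
have Lrow (c : I -> C) (j : 'I_#|sG|) :
    ((\row_i c (enum_val i)) *m L) 0 j = \sum_i c i * lam i (enum_val j).
  rewrite mxE (reindex (fun i : 'I_#|I| => enum_val i)) /=; last first.
    by exists enum_rank => ? _; rewrite ?enum_valK ?enum_rankK.
  by apply: eq_bigr => i _; rewrite !mxE.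
have Lfree : row_free L.
  apply: inj_row_free => v vL; pose c i := v 0 (enum_rank i).
  have vE : v = \row_i c (enum_val i).
    by apply/rowP => i; rewrite mxE /c enum_valK.
  have c0 : forall i, c i = 0.
    apply: Efree; rewrite -[LHS]mul1mx -Socle1; apply/sub_kermxP/sumsmx_subP => W _.
    apply/sub_kermxP; rewrite sumE -(enum_rankK W) -Lrow -vE vL mxE.
    by rewrite enum_rankK scale0r.
  by apply/rowP => i; rewrite vE !mxE c0.
have Lfull : row_full L.
  rewrite -sub1mx; apply/row_subP => j; rewrite row1.
  pose W : sG := enum_val j; pose W' := (\sum_(V : sG | V != W) V)%MS.
  have dxW : (W :&: W')%MS = 0 by move/mxdirect_sumsP: (Socle_direct sG) => ->.
  have modW (V : sG) : mxmodule rG V by apply: component_mx_module.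
  have [c Pc] : exists c : I -> C, proj_mx W W' = \sum_i c i *: E i.
    apply/Espan/proj_mx_centgmx => //; last exact/mxdirect_addsP.
      exact: sumsmx_module.
    by rewrite -Socle1 /Socle (bigD1 W).
  apply/submxP; exists (\row_i c (enum_val i)); apply/rowP => k; rewrite Lrow !mxE eqxx /=.
  have := sumE c (enum_val k); rewrite -Pc; case: eqVneq => [->|kj].
    rewrite proj_mx_id ?submx_refl // -{1}[X in X = _]scale1r.
    by move/eqP; rewrite -subr_eq0 -scalerBl scaler_eq0 (negPf (W0 _)) orbF subr_eq0 => /eqP.
  rewrite proj_mx_0 //; last first.
    by apply: (sumsmx_sup (enum_val k)) => //; rewrite (inj_eq enum_val_inj).
  by move/esym/eqP; rewrite scaler_eq0 (negPf (W0 _)) orbF => /eqP.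
by rewrite /num_irr_constituents -[LHS](eqP Lfull) (eqP Lfree).
Qed.

End CommutantDimension.

(** * Finite chain rings *)

Lemma card_constant_fibers (T S : finType) (f : T -> S) (D : {set T}) k :
  {in D, forall a, #|[set b in D | f b == f a]| = k} ->
  #|D| = (#|f @: D| * k)%N.
Proof.
move=> fk; rewrite -sum1_card (partition_big_imset f) /= -sum_nat_const.
apply: eq_bigr => _ /imsetP[a Da ->]; rewrite -(fk a Da) -sum1_card.
by apply: eq_bigl => b; rewrite inE.
Qed.

(** Squaring is two-to-one on the non-zero elements, so with zero there are (#|F| + 1) / 2
    squares. *)
Lemma card_squares_gt (F : finFieldType) :
  (2 : F) != 0 -> (#|F| < 2 * #|[set z ^+ 2 | z : F]|)%N.
Proof.
move=> F2; pose f (z : F) := z ^+ 2; set S := imset _ _.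
pose D := ~: [set (0 : F)].
have DE z : (z \in D) = (z != 0) by rewrite !inE.
have cD : #|D| = (#|f @: D| * 2)%N.
  apply: card_constant_fibers => a; rewrite DE => a0.
  suff -> : [set b in D | f b == f a] = [set a; - a].
    by rewrite cards2 -subr_eq0 opprK -mulr2n -mulr_natl mulf_neq0.
  apply/setP => b; rewrite in_set in_set2 DE /f eqf_sqr.
  case: eqVneq => // ->; apply/esym/negbTE/norP.
  by rewrite ![0 == _]eq_sym oppr_eq0.
have fD : f @: D = S :\ 0.
  apply/setP => c; rewrite in_setD1; apply/imsetP/andP => [[z]|[c0 /imsetP[z _ cz]]].
    by rewrite DE => z0 ->; rewrite expf_neq0 // imset_f.
  exists z => //; rewrite DE; apply: contraNneq c0 => z0.
  by rewrite cz z0 expr0n.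
have := cardsC [set (0 : F)]; rewrite cards1 -/D cD fD => <-.
have S0 : 0 \in S by apply/imsetP; exists 0; rewrite ?expr0n.
by rewrite (cardsD1 0 S) S0 mulnDr mulnC.
Qed.

(* Pigeonhole: the sets [a s^2] and [c - b t^2] each contain more than half of the field. *)
Lemma binary_form_universal (F : finFieldType) (a b c : F) :
  (2 : F) != 0 -> a != 0 -> b != 0 -> exists s t, a * s ^+ 2 + b * t ^+ 2 = c.
Proof.
move=> F2 a0 b0; set S := [set z ^+ 2 | z : F].
pose A := [set a * s | s in S]; pose B := [set c - b * t | t in S].
have cA : #|A| = #|S| by apply: card_imset; apply: mulfI.
have cB : #|B| = #|S|.
  by apply: card_imset => s t /(@addrI _ _ _ _)/oppr_inj; apply: mulfI.
have : A :&: B != set0.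
  apply/eqP => AB; have := cardsUI A B; rewrite AB cards0 addn0 cA cB.
  by move=> AUB; have := max_card (mem (A :|: B)); rewrite AUB addnn -mul2n leqNgt card_squares_gt.
case/set0Pn => z /setIP[/imsetP[_ /imsetP[s _ ->] zs] /imsetP[_ /imsetP[t _ ->] zt]].
by exists s, t; rewrite -zs zt subrK.
Qed.

(** An elementwise form of the hypotheses on R: x generates the maximal ideal, l is its nilpotency
    degree and 2 is invertible. Every non-zero element is then a power of x times a unit. *)
Record chain_ring (R : finComUnitRingType) (x : R) (l : nat) : Prop := ChainRing {
  chain_gt0 : (0 < l)%N;
  chain_nil : x ^+ l = 0;
  chain_nil_min : x ^+ l.-1 != 0;
  chain_nonunit : forall r, r \isn't a GRing.unit -> exists s, r = x * s;
  chain_unit2 : (2 : R) \is a GRing.unit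
}.

Section ChainRing.
Variables (R : finComUnitRingType) (x : R) (l : nat).
Hypothesis xl : chain_ring x l.
Let l_gt0 := chain_gt0 xl.
Let x_nil := chain_nil xl.
Let x_nil1 := chain_nil_min xl.
Let nonunit := chain_nonunit xl.
Let unit2 := chain_unit2 xl.
Implicit Types r s t u : R.

Lemma mulx_nonunit s : x * s \isn't a GRing.unit.
Proof.
apply/negP => /(unitrX l); rewrite exprMn x_nil mul0r unitr0.
by [].
Qed.

Lemma unitDx u s : u \is a GRing.unit -> u + x * s \is a GRing.unit.
Proof.
move=> uu; apply/negPn/negP => /nonunit[t /(canRL (addrK _)) ut].
by move: uu; rewrite ut -mulrBr (negPf (mulx_nonunit _)).
Qed.

Lemma unitD_nonunit u r :
  u \is a GRing.unit -> r \isn't a GRing.unit -> u + r \is a GRing.unit.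
Proof. by move=> uu /nonunit[s ->]; apply: unitDx. Qed.

(* The left-hand side is an injective function of t, hence a bijection of the finite ring. *)
Lemma hensel_quadratic c e : exists t, 2 * t + x * c * t ^+ 2 = e.
Proof.
pose f t := 2 * t + x * c * t ^+ 2.
have fI : injective f.
  move=> s t /eqP; rewrite -subr_eq0 /f.
  have -> : 2 * s + x * c * s ^+ 2 - (2 * t + x * c * t ^+ 2) =
            (2 + x * (c * (s + t))) * (s - t) by ring.
  by rewrite mulrI_eq0 ?subr_eq0; [move/eqP | apply/mulrI/unitDx].
by have [g _ gK] := injF_bij fI; exists (g e); apply: gK.
Qed.

Lemma expx_eq0 k : (x ^+ k == 0) = (l <= k)%N.
Proof.
apply/eqP/idP => [xk|/subnK <-]; last by rewrite exprD x_nil mulr0.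
rewrite leqNgt; apply: contra x_nil1 => kl.
have /subnK <- : (k <= l.-1)%N by lia.
by rewrite exprD xk mulr0.
Qed.

Lemma expx_unit_eq0 k u : u \is a GRing.unit -> (x ^+ k * u == 0) = (l <= k)%N.
Proof.
move=> uu; rewrite -expx_eq0; apply/eqP/eqP => [|->]; last by rewrite mul0r.
by move/(congr1 (fun z => z * u^-1)); rewrite mulrK // mul0r.
Qed.

(** The exponent grows by one at a time: if s = x^j t with j < l - k and t were a unit, x^k s would
    be x^(k + j) times a unit, hence non-zero. *)
Lemma ann_expx k s : (k <= l)%N -> x ^+ k * s = 0 -> exists t, s = x ^+ (l - k) * t.
Proof.
move=> kl xs.
suff H j : (j <= l - k)%N -> exists t, s = x ^+ j * t by exact: H.
elim: j => [_|j IH jk].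
  by exists s; rewrite expr0 mul1r.
have [t st] := IH (ltnW jk).
have [tu|/nonunit[t' tt]] := boolP (t \is a GRing.unit).
  move/eqP: xs; rewrite st mulrA -exprD expx_unit_eq0 //; lia.
by exists t'; rewrite st tt mulrA exprSr.
Qed.

(** Otherwise the sum 2 s would lie in the maximal ideal. *)
Lemma unitr_sub_or_add s t :
  s \is a GRing.unit -> s - t \is a GRing.unit \/ s + t \is a GRing.unit.
Proof.
move=> su; have [|/nonunit[a sa]] := boolP (s - t \is a GRing.unit); first by left.
right; apply/negPn/negP => /nonunit[b sb].
have : 2 * s = x * (a + b) by rewrite mulrDr -sa -sb; ring.
by move=> e; have := mulx_nonunit (a + b); rewrite -e unitrM unit2 su.
Qed.

(** * Cardinalities of ideals, unit multiples and square multiples *)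

Section Counting.
Variables (F : finFieldType) (pi : {rmorphism R -> F}).
Hypothesis pi_surj : forall c : F, exists r, pi r = c.
Hypothesis pi_ker : forall r, pi r = 0 <-> exists s, r = x * s.
Local Notation q := #|F|.

Lemma pi_unit r : (r \is a GRing.unit) = (pi r != 0).
Proof.
apply/idP/idP => [ru|pr]; first by rewrite -unitfE rmorph_unit.
apply/negPn/negP => /nonunit/pi_ker pr0; by rewrite pr0 eqxx in pr.
Qed.

(** Each step splits off a leading digit: (c, z) |-> x^j [lift c] + z is a bijection from the
    product of the residue field and the ideal of x^(j + 1) onto the ideal of x^j. *)
Lemma card_expx_ideal j : (j <= l)%N -> #|[set x ^+ j * s | s : R]| = (q ^ (l - j))%N.
Proof.
move=> jl; have [k] : exists k, k = (l - j)%N by exists (l - j)%N.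
elim: k => [|k IH] in j jl *.
  move=> lj; rewrite -lj expn0; have -> : j = l by lia.
  apply/eqP/cards1P; exists 0; apply/setP => r; rewrite inE.
  apply/imsetP/eqP => [[s _ ->]|->]; first by rewrite x_nil mul0r.
  by exists 0; rewrite ?mulr0.
move=> kl; have jl' : (j < l)%N by lia.
have [lift liftK] : exists lift : F -> R, forall c, pi (lift c) = c.
  exact: fin_all_exists pi_surj.
rewrite -kl expnS; have kl' : k = (l - j.+1)%N by lia.
rewrite [in RHS]kl' -(IH _ jl' kl') -[#|F|]cardsT -cardsX.
pose f (cz : F * R) := x ^+ j * lift cz.1 + cz.2.
rewrite -[RHS](card_in_imset (f := f)); last first.
  move=> [c z] [c' z'] /setXP[_ /imsetP[s _ /= ->]] /setXP[_ /imsetP[s' _ /= ->]].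
  rewrite /f /= => e; suff cc : c = c' by move: e; rewrite cc => /addrI ->.
  have : x ^+ j * (lift c - lift c' + x * (s - s')) = 0.
    rewrite -(subrr (x ^+ j * lift c + x ^+ j.+1 * s)) {2}e exprSr; ring.
  move/eqP; apply: contraTeq => cc; rewrite expx_unit_eq0 -?ltnNge //.
  by apply: unitDx; rewrite pi_unit rmorphB /= !liftK subr_eq0.
apply: eq_card => r; apply/imsetP/imsetP => [[s _ ->]|[[c _] /setXP[_ /imsetP[s _ /= ->]] ->]].
  have [t st] : exists t, s - lift (pi s) = x * t.
    by apply/pi_ker; rewrite rmorphB /= liftK subrr.
  exists (pi s, x ^+ j.+1 * t); first by rewrite inE /= inE imset_f.
  by rewrite /f /= exprSr -mulrA -st -mulrDr addrC subrK.
by exists (lift c + x * s) => //; rewrite mulrDr mulrA exprSr.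
Qed.

(** The set is the difference of the ideals generated by x^j and x^(j + 1). *)
Lemma card_expx_units j : (j < l)%N ->
  #|[set x ^+ j * u | u : R & u \is a GRing.unit]| = (q ^ (l - j) - q ^ (l - j.+1))%N.
Proof.
move=> jl; rewrite -(card_expx_ideal jl) -(card_expx_ideal (ltnW jl)).
rewrite -cardsDS; last first.
  by apply/subsetP => _ /imsetP[s _ ->]; rewrite exprSr -mulrA imset_f.
apply: eq_card => r; rewrite in_setD.
apply/imsetP/andP => [[u /[!inE] uu ->]|[r1 /imsetP[s _ rs]]].
  split; last exact: imset_f.
  apply/imsetP => -[s _ /eqP]; rewrite -subr_eq0 exprSr -mulrA -mulrBr -mulrN.
  by rewrite expx_unit_eq0 1?leqNgt ?jl //; apply: unitDx.
exists s; rewrite ?inE //; apply: contraNT r1 => /nonunit[t st].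
by rewrite rs st mulrA -exprSr imset_f.
Qed.

(** On units, the fibres of u |-> x^j u are cosets of the annihilator of x^j, and those of u |-> x^j
    b u^2 are twice as large: if x^j (t - s) (t + s) = 0, one of the last two factors is a unit, so
    t is congruent to s or to -s, and never to both. *)
Lemma card_expx_squares j (b : R) : (j < l)%N -> b \is a GRing.unit ->
  (#|[set (x ^+ j * (b * u ^+ 2))%R | u : R & u \is a GRing.unit]| * 2 =
   q ^ (l - j) - q ^ (l - j.+1))%N.
Proof.
move=> jl bu; rewrite -(card_expx_units jl).
pose U := [set u : R | u \is a GRing.unit].
pose f u := x ^+ j * u; pose g u := x ^+ j * (b * u ^+ 2).
pose K := #|[set s : R | x ^+ j * s == 0]|.
have UE (h : R -> R) : [set h u | u : R & u \is a GRing.unit] = h @: U.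
  by apply/setP => r; apply/imsetP/imsetP => -[u]; rewrite ?inE => uu ->; exists u; rewrite ?inE.
have Ann s t : s \in U -> x ^+ j * s = x ^+ j * t -> t \in U.
  rewrite !inE => su st; apply: contraLR jl => /nonunit[a ta].
  rewrite -leqNgt -(expx_unit_eq0 j (unitDx (- a) su)) mulrDr st ta; apply/eqP; ring.
have fibre s : s \in U -> #|[set t in U | f t == f s]| = K.
  move=> su; rewrite /K -[RHS](card_imset _ (addrI s)); apply: eq_card => t.
  rewrite in_set; apply/andP/imsetP => [[tu /eqP ts]|[a]].
    exists (t - s); last by rewrite addrC subrK.
    by rewrite inE mulrBr -/(f t) ts subrr.
  rewrite inE => /eqP a0 ->; split; last by rewrite /f mulrDr a0 addr0.
  by apply: (Ann s) => //; rewrite mulrDr a0 addr0.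
have fU := card_constant_fibers fibre.
have /card_constant_fibers gU : {in U, forall s, #|[set t in U | g t == g s]| = (2 * K)%N}.
  move=> s su; have nsu : - s \in U by rewrite inE unitrN; rewrite inE in su.
  rewrite mul2n -addnn -{1}(fibre _ su) -(fibre _ nsu) -cardsUI.
  rewrite [X in (_ + X)%N](_ : _ = 0%N) ?addn0; last first.
    apply/eqP; rewrite cards_eq0; apply/eqP/setP => t; rewrite !in_set.
    apply/negP => /andP[/andP[_ /eqP ->] /andP[_]]; rewrite -subr_eq0 /f -mulrBr opprK.
    rewrite -mulr2n -mulr_natl expx_unit_eq0 1?leqNgt ?jl // unitrM unit2.
    by rewrite inE in su.
  apply: eq_card => t; rewrite !(in_set, in_setU) -andb_orr.
  have [tu|//] := boolP (t \is a GRing.unit).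
  have gE : g t - g s = b * (x ^+ j * (t - s) * (t + s)) by rewrite /g; ring.
  have fE : f t - f s = x ^+ j * (t - s) by rewrite /f; ring.
  have fNE : f t - f (- s) = x ^+ j * (t + s) by rewrite /f; ring.
  rewrite -[g t == _]subr_eq0 -[f t == f s]subr_eq0 -[f t == _]subr_eq0 gE fE fNE /=.
  rewrite mulrI_eq0; last exact/mulrI.
  apply/eqP/orP => [|[/eqP ->|/eqP e]]; first last.
  - by rewrite mulrAC e mul0r.
  - by rewrite mul0r.
  move=> e; have [vu|vu] := unitr_sub_or_add s tu; [right|left].
    by apply/eqP/(mulIr vu); rewrite mul0r mulrAC.
  by apply/eqP/(mulIr vu); rewrite mul0r.
rewrite !UE -/f -/g.
have K0 : (0 < K)%N by apply/card_gt0P; exists 0; rewrite inE mulr0.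
by apply/eqP; rewrite -(eqn_pmul2r K0) -mulnA -gU fU.
Qed.

(** A solution over the residue field is lifted; the error [x * e] is left to be absorbed by
    perturbing a primitive vector ([primitive_norms_lift]). *)
Lemma diag_form_universal (a b c : R) :
  a \is a GRing.unit -> b \is a GRing.unit ->
  exists s t e, a * s ^+ 2 + b * t ^+ 2 = c + x * e.
Proof.
rewrite !pi_unit => a0 b0.
have pi2 : (2 : F) != 0 by rewrite -(rmorph_nat pi) -pi_unit.
have [s' [t' st]] := binary_form_universal (pi c) pi2 a0 b0.
have [s s'E] := pi_surj s'; have [t t'E] := pi_surj t'.
have [e] : exists e, a * s ^+ 2 + b * t ^+ 2 - c = x * e.
  apply/pi_ker; rewrite rmorphB rmorphD !rmorphM /= s'E t'E -!expr2 st.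
  exact: subrr.
by move=> ste; exists s, t, e; rewrite -ste; ring.
Qed.

End Counting.
End ChainRing.

(** * Hermitian forms over ramified extensions *)

(* Working with an abstract A = R + R y keeps the quotient-polynomial representation out of
   the computations. *)
Record ramified_ext (R : finComUnitRingType) (A : comNzRingType) (x : R)
    (io : {rmorphism R -> A}) (y : A) (star : A -> A) (re im : A -> R) : Prop :=
  RamifiedExt {
  ext_sqr : y * y = io x;
  ext_dec : forall a, a = io (re a) + io (im a) * y;
  ext_re : forall r s, re (io r + io s * y) = r;
  ext_im : forall r s, im (io r + io s * y) = s;
  ext_star : forall r s, star (io r + io s * y) = io r - io s * y
}.

Section RamifiedExt.
Variables (R : finComUnitRingType) (x : R) (l : nat).
Hypothesis xl : chain_ring x l.
Variables (A : comNzRingType) (io : {rmorphism R -> A}) (y : A) (star : A -> A).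
Variables (re im : A -> R).
Hypothesis ext : ramified_ext x io y star re im.
Implicit Types (a b c : A) (r s t : R).

Let yy := ext_sqr ext.
Let dec := ext_dec ext.
Let reE := ext_re ext.
Let imE := ext_im ext.

Lemma re_io r : re (io r) = r.
Proof. by rewrite -[RHS](reE r 0) rmorph0 mul0r addr0. Qed.

Lemma im_io r : im (io r) = 0.
Proof. by rewrite -[RHS](imE r 0) rmorph0 mul0r addr0. Qed.
Lemma re1 : re 1 = 1. Proof. by rewrite -(rmorph1 io) re_io. Qed.

Lemma reim_eq a b : re a = re b -> im a = im b -> a = b.
Proof. by move=> er ei; rewrite (dec a) (dec b) er ei. Qed.

Lemma decD a b : a + b = io (re a + re b) + io (im a + im b) * y.
Proof. rewrite {1}(dec a) {1}(dec b) !rmorphD /=; ring. Qed.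

Lemma decM a b :
  a * b = io (re a * re b + x * (im a * im b)) + io (re a * im b + im a * re b) * y.
Proof. rewrite {1}(dec a) {1}(dec b) !rmorphD !rmorphM -yy /=; ring. Qed.

Lemma reD a b : re (a + b) = re a + re b. Proof. by rewrite decD reE. Qed.
Lemma imD a b : im (a + b) = im a + im b. Proof. by rewrite decD imE. Qed.
Lemma reM a b : re (a * b) = re a * re b + x * (im a * im b).
Proof. by rewrite decM reE. Qed.
Lemma imM a b : im (a * b) = re a * im b + im a * re b.
Proof. by rewrite decM imE. Qed.
Lemma re_y : re y = 0.
Proof. by rewrite -[RHS](reE 0 1) rmorph0 rmorph1 mul1r add0r. Qed.
Lemma im_y : im y = 1.
Proof. by rewrite -[RHS](imE 0 1) rmorph0 rmorph1 mul1r add0r. Qed.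
Lemma reN a : re (- a) = - re a.
Proof. by rewrite -mulN1r -(rmorphN1 io) reM re_io im_io; ring. Qed.
Lemma imN a : im (- a) = - im a.
Proof. by rewrite -mulN1r -(rmorphN1 io) imM re_io im_io; ring. Qed.
Lemma im1 : im 1 = 0. Proof. by rewrite -(rmorph1 io) im_io. Qed.
Lemma re_mul_io r a : re (io r * a) = r * re a.
Proof. rewrite reM re_io im_io; ring. Qed.
Lemma re_star a : re (star a) = re a.
Proof. by rewrite (dec a) (ext_star ext) -mulNr -rmorphN !reE. Qed.
Lemma im_star a : im (star a) = - im a.
Proof. by rewrite (dec a) (ext_star ext) -mulNr -rmorphN !imE. Qed.

Lemma starD a b : star (a + b) = star a + star b.
Proof. by apply: reim_eq; rewrite ?(reD, imD, re_star, im_star) // opprD. Qed.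
Lemma starM a b : star (a * b) = star a * star b.
Proof. apply: reim_eq; rewrite ?(reM, imM, re_star, im_star); ring. Qed.
Lemma starK : involutive star.
Proof. by move=> a; apply: reim_eq; rewrite ?(re_star, im_star) ?opprK. Qed.
Lemma star_io r : star (io r) = io r.
Proof. by apply: reim_eq; rewrite ?(re_star, im_star) ?im_io ?oppr0. Qed.
Lemma star0 : star 0 = 0. Proof. by rewrite -(rmorph0 io) star_io. Qed.
Lemma star1 : star 1 = 1. Proof. by rewrite -(rmorph1 io) star_io. Qed.
Lemma starN a : star (- a) = - star a.
Proof. by apply/eqP; rewrite -addr_eq0 -starD addNr star0. Qed.
Lemma star_y : star y = - y.
Proof. by apply: reim_eq; rewrite ?(re_star, im_star, reN, imN) // re_y oppr0. Qed.
Lemma starX a k : star (a ^+ k) = star a ^+ k.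
Proof. by elim: k => [|k IH]; rewrite ?star1 // !exprS starM IH. Qed.

Lemma star_real a : star a = a -> a = io (re a).
Proof.
move=> sa; apply: reim_eq; rewrite ?re_io ?im_io //.
apply: (mulrI (chain_unit2 xl)); rewrite mulr0 mulr_natl mulr2n -{1}sa im_star.
exact: addNr.
Qed.
Lemma norm_re a : a * star a = io (re a ^+ 2 - x * im a ^+ 2).
Proof. by apply: reim_eq; rewrite ?(reM, imM, re_star, im_star, re_io, im_io); ring. Qed.

(** The inverse of [a] when [re a] is a unit, obtained by dividing [star a] by the norm
    [a * star a], which lies in R; without meaning otherwise. *)
Definition exti a := io (re a ^+ 2 - x * im a ^+ 2)^-1 * star a.

Lemma mul_exti a : re a \is a GRing.unit -> a * exti a = 1.
Proof.
move=> ua; rewrite /exti mulrCA norm_re -rmorphM mulVr ?rmorph1 //.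
by rewrite -mulrN; apply: (unitDx xl); rewrite unitrX.
Qed.

(** Together with [mul_exti]: a is a unit exactly when [re a] is one. Units of A are tested in this
    way throughout. *)
Lemma nonunit_ext a : re a \isn't a GRing.unit -> exists b, a = y * b.
Proof.
case/(chain_nonunit xl) => s sa; exists (io (im a) + io s * y).
rewrite {1}(dec a) sa rmorphM -yy; ring.
Qed.

Lemma re_mulyn b : re (y * b) \isn't a GRing.unit.
Proof. by rewrite reM re_y mul0r add0r im_y mul1r (mulx_nonunit xl). Qed.

Lemma re_unitM a b :
  (re (a * b) \is a GRing.unit) = (re a \is a GRing.unit) && (re b \is a GRing.unit).
Proof.
rewrite reM; apply/idP/andP => [uab|[ua ub]].
  have : re a * re b \is a GRing.unit.
    by rewrite -(addrK (x * (im a * im b)) (re a * re b)) -mulrN; apply: (unitDx xl).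
  by rewrite unitrM => /andP.
by apply: (unitDx xl); rewrite unitrM ua ub.
Qed.

Lemma y_double k : y ^+ (k.*2) = io (x ^+ k).
Proof. by rewrite -mul2n exprM expr2 yy rmorphXn. Qed.

Lemma y_nil : y ^+ (l.*2) = 0.
Proof. by rewrite y_double (chain_nil xl) rmorph0. Qed.

Lemma ynil_ge k : (l.*2 <= k)%N -> y ^+ k = 0.
Proof. by move/subnK <-; rewrite exprD y_nil mulr0. Qed.

(** The real and imaginary parts of [y * a] are x im a and re a. So a is im a y with im a divisible
    by x^(l - 1), and x^(l - 1) y = y^(2l - 1). *)
Lemma ann_y a : y * a = 0 -> exists b, a = y ^+ (l.*2.-1) * b.
Proof.
move=> ya; have rea : re a = 0.
  by have := congr1 im ya; rewrite imM re_y im_y mul0r add0r mul1r -(rmorph0 io) im_io.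
have [] : exists t, im a = x ^+ (l - 1) * t.
  apply: (ann_expx xl) (chain_gt0 xl) _; rewrite expr1.
  by have := congr1 re ya; rewrite reM re_y im_y mul0r add0r mul1r -(rmorph0 io) re_io.
move=> t it; exists (io t).
have -> : l.*2.-1 = ((l - 1).*2.+1)%N by have := chain_gt0 xl; lia.
rewrite {1}(dec a) rea rmorph0 add0r it exprS y_double rmorphM; ring.
Qed.

Lemma ann_yX k a : (k <= l.*2)%N -> y ^+ k * a = 0 -> exists b, a = y ^+ (l.*2 - k) * b.
Proof.
elim: k a => [|k IH] a kl.
  by rewrite expr0 mul1r subn0 => ->; exists 0; rewrite mulr0.
rewrite exprSr -mulrA => /(IH _ (ltnW kl))[b yb].
have [|c ac] := @ann_y (a - y ^+ (l.*2 - k.+1) * b).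
  by rewrite mulrBr yb mulrA -exprS -subSn // subSS subrr.
exists (b + y ^+ k * c); rewrite mulrDr mulrA -exprD.
have -> : (l.*2 - k.+1 + k = l.*2.-1)%N by lia.
by rewrite -ac addrC subrK.
Qed.

Section Hermitian.
Variables (V : finLmodType A) (h : V -> V -> A).
Hypothesis hDl : forall u u' v, h (u + u') v = h u v + h u' v.
Hypothesis hDr : forall u v v', h u (v + v') = h u v + h u v'.
Hypothesis hZr : forall a u v, h u (a *: v) = a * h u v.
Hypothesis hS : forall u v, h v u = star (h u v).
Hypothesis h_inj : forall v, (forall u, h v u = 0) -> v = 0.
Hypothesis ann_V : forall k (v : V), (k <= l.*2)%N -> y ^+ k *: v = 0 ->
  exists w, v = y ^+ (l.*2 - k) *: w.
Hypothesis V_nontriv : exists v : V, v != 0.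
Implicit Types (u v w z e : V) (g : V -> V).

Lemma hZl a u v : h (a *: u) v = star a * h u v.
Proof. by rewrite hS hZr starM -hS. Qed.
Lemma h0r u : h u 0 = 0. Proof. by rewrite -(scale0r (0 : V)) hZr mul0r. Qed.
Lemma h0l u : h 0 u = 0. Proof. by rewrite hS h0r star0. Qed.
Lemma hNr u v : h u (- v) = - h u v. Proof. by rewrite -scaleN1r hZr mulN1r. Qed.
Lemma hNl u v : h (- u) v = - h u v. Proof. by rewrite hS hNr starN -hS. Qed.
Lemma hBr u v v' : h u (v - v') = h u v - h u v'. Proof. by rewrite hDr hNr. Qed.
Lemma hBl u u' v : h (u - u') v = h u v - h u' v. Proof. by rewrite hDl hNl. Qed.
Lemma h_sumr (I : finType) (F : I -> V) u : h u (\sum_i F i) = \sum_i h u (F i).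
Proof. by elim/big_rec2: _ => [|i a b _ <-]; rewrite ?h0r ?hDr. Qed.
Lemma h_suml (I : finType) (F : I -> V) u : h (\sum_i F i) u = \sum_i h (F i) u.
Proof. by elim/big_rec2: _ => [|i a b _ <-]; rewrite ?h0l ?hDl. Qed.

Definition norm v := re (h v v).

Lemma h_norm v : h v v = io (norm v).
Proof. by apply: star_real; rewrite -hS. Qed.

Lemma normD u v : norm (u + v) = norm u + norm v + 2 * re (h u v).
Proof. rewrite /norm hDl !hDr !reD [h v u]hS re_star; ring. Qed.

Lemma normZ a v : norm (a *: v) = (re a ^+ 2 - x * im a ^+ 2) * norm v.
Proof. by rewrite /norm hZl hZr mulrA [_ * a]mulrC norm_re h_norm -rmorphM !re_io. Qed.

(** These are the vectors outside yV. Stating it through h makes the dual vector z available at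
    once. *)
Definition primitive v := [exists z, h v z == 1].

Lemma primitiveP v :
  reflect (exists z, re (h v z) \is a GRing.unit) (primitive v).
Proof.
apply: (iffP existsP) => [[z /eqP hz]|[z uz]]; first by exists z; rewrite hz re1 unitr1.
by exists (exti (h v z) *: z); rewrite hZr mulrC mul_exti.
Qed.

(** All values h (v, u) lie in yA, so y^(2l - 1) v is orthogonal to V and vanishes by nondegeneracy;
    [ann_V] then divides v by y. *)
Lemma nonprimitive v : ~~ primitive v -> exists w, v = y *: w.
Proof.
move=> vp; have l0 := chain_gt0 xl.
have [] := @ann_V (l.*2.-1) v.
- by rewrite leq_pred.
- apply: h_inj => u; rewrite hZl.
  have [|b ->] := @nonunit_ext (h v u).
    by apply: contra vp => uv; apply/primitiveP; exists u.
  rewrite starX star_y exprNn -mulrA [y ^+ _ * _]mulrA -exprSr prednK; last by lia.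
  by rewrite y_nil mul0r mulr0.
move=> w vw; exists w; rewrite vw; congr (_ *: w).
by have -> : (l.*2 - l.*2.-1 = 1)%N by lia.
Qed.

Lemma primitive_div k v :
  (exists i w, [/\ (i < k)%N, primitive w & v = y ^+ i *: w]) \/ exists w, v = y ^+ k *: w.
Proof.
elim: k => [|k [[i [w [ik pw vw]]]|[w vw]]]; first by right; exists v; rewrite scale1r.
  by left; exists i, w; split; rewrite // ltnS ltnW.
have [pw|/nonprimitive[w' ww]] := boolP (primitive w).
  by left; exists k, w; split.
by right; exists w'; rewrite vw ww scalerA -exprSr.
Qed.

Lemma primitive_exists : exists w, primitive w.
Proof.
have [v v0] := V_nontriv.
have [[i [w [_ pw _]]]|[w vw]] := primitive_div (l.*2) v; first by exists w.
by move: v0; rewrite vw y_nil scale0r eqxx.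
Qed.

Lemma primitive_decomp v :
  exists i w, [/\ (i <= l.*2)%N, primitive w & v = y ^+ i *: w].
Proof.
have [[i [w [il pw vw]]]|[w vw]] := primitive_div (l.*2) v.
  by exists i, w; split => //; apply: ltnW.
(* Here v = 0; it is written as y^(2l) times an arbitrary primitive vector. *)
have [w' pw'] := primitive_exists.
by exists (l.*2), w'; rewrite vw y_nil !scale0r.
Qed.

(** * Isometries and Witt's theorem for primitive vectors *)

Definition isometry (g : V -> V) : Prop :=
  [/\ forall u v, g (u + v) = g u + g v,
      forall a v, g (a *: v) = a *: g v &
      forall u v, h (g u) (g v) = h u v].

Definition isoconj u v := exists2 g : {perm V}, isometry g & g u = v.

Lemma isometry_perm g : isometry g -> exists2 p : {perm V}, isometry p & p =1 g.
Proof.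
case=> gD gZ gh; have gI : injective g.
  move=> u v guv; apply/eqP; rewrite -subr_eq0; apply/eqP/h_inj => z.
  by rewrite hBl -(gh u) -(gh v) guv subrr.
by exists (perm gI); [split=> *; rewrite !permE | move=> u; rewrite permE].
Qed.

Lemma conjugate_refl u : isoconj u u.
Proof. by exists 1%g; [split=> *; rewrite !perm1 | rewrite perm1]. Qed.

Lemma conjugate_trans v u w : isoconj u v -> isoconj v w -> isoconj u w.
Proof.
move=> [f [fD fZ fh] <-] [g [gD gZ gh] <-]; exists (f * g)%g; last by rewrite permM.
by split=> *; rewrite !permM ?fD ?fZ ?gD ?gZ ?gh.
Qed.

Lemma conjugate_sym u v : isoconj u v -> isoconj v u.
Proof.
move=> [g [gD gZ gh] <-]; exists (g^-1)%g; last by rewrite permK.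
split=> [z z'|a z|z z']; try by apply: (@perm_inj _ g); rewrite ?gD ?gZ !permKV.
by rewrite -gh !permKV.
Qed.

Lemma conjugateZ a u v : isoconj u v -> isoconj (a *: u) (a *: v).
Proof. by move=> [g [gD gZ gh] <-]; exists g. Qed.

Lemma conjugateN u : isoconj (- u) u.
Proof.
have [|p pI pN] := @isometry_perm (fun v => - v); last by exists p; rewrite ?pN ?opprK.
by split=> [v w|a v|v w]; rewrite ?opprD ?scalerN // hNl hNr opprK.
Qed.

Lemma isometry_norm g v : isometry g -> norm (g v) = norm v.
Proof. by case=> _ _ gh; rewrite /norm gh. Qed.

Lemma isometry_transvection e c :
  c + star c + c * star c * h e e = 0 -> isometry (fun v => v + (c * h e v) *: e).
Proof.
move=> cc; split=> [v v'|a v|v v'].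
- by rewrite hDr mulrDr scalerDl addrACA.
- by rewrite hZr scalerDr scalerA mulrCA.
rewrite !(hDl, hDr, hZl, hZr) starM [h v e]hS.
set s := h e v; set s' := h e v'.
have -> : h v v' + c * s' * star s + (star c * star s * s' + star c * star s * (c * s' * h e e))
   = h v v' + star s * s' * (c + star c + c * star c * h e e) by ring.
by rewrite cc mulr0 addr0.
Qed.

(* The quasi-reflection v |-> v + c h(e, v) e with e = w - u and c = h(e, u)^-1. *)
Lemma conjugate_reflection u w :
  norm u = norm w -> re (h (w - u) u) \is a GRing.unit -> isoconj u w.
Proof.
move=> uw; set e := w - u; set d := h e u => ud.
pose c := exti d; have cd : c * d = 1 by rewrite mulrC mul_exti.
have scd : star c * star d = 1 by rewrite -starM cd star1.
(* Equality of the norms enters here; division by d [star d] yields the condition of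
   [isometry_transvection]. *)
have tr0 : d + star d + h e e = 0.
  have -> : h e e = h w w - h u w - d by rewrite -hBl -hBr.
  have -> : star d = h u w - h u u by rewrite -hS hBr.
  by rewrite !h_norm uw; ring.
have cc : c + star c + c * star c * h e e = 0.
  have -> : h e e = - (d + star d) by apply/eqP; rewrite -addr_eq0 addrC tr0.
  have -> : c + star c + c * star c * - (d + star d) =
    c + star c - (c * d) * star c - c * (star c * star d) by ring.
  by rewrite cd scd; ring.
have [p pI pE] := isometry_perm (isometry_transvection cc).
by exists p; rewrite ?pE -/d ?cd ?scale1r // addrC subrK.
Qed.

(** Since norm u - re h (w, u) and norm u + re h (w, u) are not both non-units, a reflection takes u
    to w or to -w; the second case is corrected by the isometry -1. *)
Lemma conjugate_unit_norm u w :
  norm u \is a GRing.unit -> norm u = norm w -> isoconj u w.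
Proof.
move=> uu uw; have [|] := unitr_sub_or_add xl (re (h w u)) uu => [v|v].
  apply: conjugate_reflection => //.
  by rewrite hBl reD reN -unitrN opprD opprK addrC.
apply/conjugate_trans/conjugateN/conjugate_reflection.
  by rewrite uw -scaleN1r normZ reN imN re1 im1; ring.
by rewrite hBl hNl reD !reN -unitrN opprD !opprK addrC.
Qed.

Lemma re_h_sym u v : re (h v u) = re (h u v).
Proof. by rewrite hS re_star. Qed.

Lemma conjugate_nonunit_norm u w :
  norm u \isn't a GRing.unit -> norm u = norm w -> re (h w u) \is a GRing.unit ->
  isoconj u w.
Proof.
move=> nu uw wu; apply: conjugate_reflection => //.
by rewrite hBl reD reN; apply: (unitD_nonunit xl); rewrite ?unitrN.
Qed.

(** If the dual vector z of u fails for w, and z' of w fails for u, then z + z' serves both. *)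
Lemma common_dual u w : primitive u -> primitive w ->
  exists z, re (h z u) \is a GRing.unit /\ re (h z w) \is a GRing.unit.
Proof.
move=> /primitiveP[z uz] /primitiveP[z' wz']; rewrite re_h_sym in uz.
have [zw|zw] := boolP (re (h z w) \is a GRing.unit); first by exists z.
rewrite re_h_sym in wz'.
have [zu|zu] := boolP (re (h z' u) \is a GRing.unit); first by exists z'.
exists (z + z'); rewrite !hDl !reD; split; first exact: (unitD_nonunit xl).
by rewrite addrC; apply: (unitD_nonunit xl).
Qed.

(** When neither the norms nor h (w, u) are units, two reflections pass through some v = z + a u of
    the same norm, where z pairs to units with u and w. Adding a multiple of u preserves this, as h
    (u, u) and h (u, w) are non-units. *)
Lemma witt_primitive u w :
  primitive u -> primitive w -> norm u = norm w -> isoconj u w.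
Proof.
move=> pu pw uw; have [uu|uu] := boolP (norm u \is a GRing.unit).
  exact: conjugate_unit_norm.
have [wu|wu] := boolP (re (h w u) \is a GRing.unit); first exact: conjugate_nonunit_norm.
have [z [zu zw]] := common_dual pu pw.
have [c uc] := chain_nonunit xl uu.
(* With this factor h (z, e t u) = t, so norm v = norm z + 2 t + norm u (e [star e]) t^2; as norm u
   is divisible by x, Hensel's argument gives t. *)
pose e := exti (h z u).
have [t tE] := hensel_quadratic xl (c * (re e ^+ 2 - x * im e ^+ 2)) (norm u - norm z).
pose v := z + (e * io t) *: u.
have vu : norm v = norm u.
  rewrite normD normZ hZr (_ : e * io t * h z u = io t); last first.
    by rewrite mulrAC [e * _]mulrC mul_exti // mul1r.
  rewrite re_io reM imM !re_io !im_io -[RHS](subrK (norm z)) -tE uc; ring.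
have hv z' : re (h u z') \isn't a GRing.unit -> re (h z z') \is a GRing.unit ->
    re (h v z') \is a GRing.unit.
  move=> uz' zz'; rewrite hDl reD hZl; apply: (unitD_nonunit xl) => //.
  by rewrite re_unitM (negPf uz') andbF.
apply: (@conjugate_trans v); first by apply: conjugate_nonunit_norm; rewrite ?vu ?hv.
by apply: conjugate_nonunit_norm; rewrite ?vu // re_h_sym hv // re_h_sym.
Qed.

(** With h (w, z) = 1, the norm changes by x^k (2 s + x^k norm z s^2), and k > 0 makes the bracket
    surjective in s. *)
Lemma norm_adjust w k t : (0 < k)%N -> primitive w ->
  exists s z, let w' := w + io (x ^+ k * s) *: z in
    primitive w' /\ norm w' = norm w + x ^+ k * t.
Proof.
case: k => // k _ pw; have /existsP[z /eqP wz] := pw.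
have [s sE] := hensel_quadratic xl (x ^+ k * norm z) t.
exists s, z; split.
  apply/primitiveP; exists z; rewrite hDl wz hZl star_io h_norm -rmorphM.
  by rewrite reD re_io re1 exprS -!mulrA; apply: (unitDx xl _ (unitr1 _)).
rewrite normD normZ hZr wz mulr1 !re_io im_io -sE [x ^+ k.+1]exprS; ring.
Qed.

(** Already y^(2l - 1) = x^(l - 1) y suffices, because real parts of multiples of y lie in xR. This
    gain of one exponent is what handles odd layers. *)
Lemma re_ytop k a : (l.*2 <= k.+1)%N -> re (y ^+ k * a) = 0.
Proof.
move=> lk; have -> : k = (l.*2.-1 + (k - l.*2.-1))%N by lia.
have l0 := chain_gt0 xl.
have -> : l.*2.-1 = (l.-1.*2.+1)%N by lia.
rewrite exprD exprS y_double -!mulrA reM re_y im_y mul0r add0r mul1r imM im_io re_io.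
by rewrite mul0r addr0 mulrA -exprS prednK // (chain_nil xl) mul0r.
Qed.

(** If g takes y^i u to y^i w, then g u - w lies in y^(2l - i) V and alters the norm only by terms
    that x^j kills. Conversely, the norms differ by a multiple of x^(l - j), and u can be corrected
    by a vector in x^(l - j) V, which y^i kills; Witt's theorem then applies. *)
Lemma conjugate_layer i u w : (i < l.*2)%N -> primitive u -> primitive w ->
  isoconj (y ^+ i *: u) (y ^+ i *: w) <-> x ^+ i./2 * norm u = x ^+ i./2 * norm w.
Proof.
move=> il pu pw; set j := i./2.
have /andP[ij ji] : (i <= j.*2.+1)%N && (j.*2 <= i)%N.
  by have := odd_double_half i; rewrite -/j => <-; rewrite leq_addl -add1n leq_add2r leq_b1.
split.
  move=> [g gI]; case: (gI) => gD gZ gh; rewrite gZ => /eqP; rewrite -subr_eq0 -scalerBr.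
  move=> /eqP/(ann_V (ltnW il))[z /(canRL (subrK _)) guE].
  rewrite -(isometry_norm u gI) guE normD /norm hZr !mulrDr.
  have re0 a : x ^+ j * re (y ^+ (l.*2 - i) * a) = 0.
    by rewrite -re_mul_io -y_double mulrA -exprD re_ytop //; lia.
  by rewrite re0 add0r mulrCA [h (_ *: _) w]hS re_star hZr re0 mulr0 addr0.
move=> uw; have jl : (j < l)%N by lia.
have [|t wt] := ann_expx xl (ltnW jl) (s := norm w - norm u).
  by rewrite mulrBr uw subrr.
have [|s [z [pu' nu']]] := @norm_adjust u (l - j) t _ pu; first by lia.
set u' := u + _ in pu' nu'.
have -> : y ^+ i *: u = y ^+ i *: u'.
  rewrite /u' scalerDr scalerA rmorphM -y_double mulrA -exprD.
  by rewrite [y ^+ (_ + _)]ynil_ge ?mul0r ?scale0r ?addr0 //; lia.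
by apply/conjugateZ/witt_primitive; rewrite // nu' -wt addrC subrK.
Qed.

(** For primitive u the least power of y that kills y^i u is y^(2l - i), as pairing with a dual
    vector shows, and isometries preserve it. *)
Lemma layer_unique i k u w : (i <= l.*2)%N -> (k <= l.*2)%N ->
  primitive u -> primitive w -> isoconj (y ^+ i *: u) (y ^+ k *: w) -> i = k.
Proof.
wlog ik : i k u w / (i < k)%N.
  move=> H il kl pu pw uw; have [ik|ki|//] := ltngtP i k; first exact: H uw.
  by apply/esym/H/conjugate_sym/uw.
move=> il kl /existsP[z /eqP uz] _ [g [gD gZ gh]].
move/(congr1 (fun v => y ^+ (l.*2 - k) *: v)); rewrite scalerA -exprD subnK // y_nil scale0r.
move=> gu; have u0 : y ^+ (l.*2 - k + i) *: u = 0.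
  apply: h_inj => v; rewrite -(gh _ v) gZ exprD -scalerA -[y ^+ i *: g u]gZ gu.
  exact: h0l.
have := hZl (y ^+ (l.*2 - k + i)) u z; rewrite u0 h0l uz mulr1 => /esym.
move/(congr1 star); rewrite starK star0 => y0.
have : y ^+ l.*2.-1 = 0.
  have -> : l.*2.-1 = (l.*2 - k + i + (l.*2.-1 - (l.*2 - k + i)))%N by lia.
  by rewrite exprD y0 mul0r.
have l0 := chain_gt0 xl; have -> : l.*2.-1 = (l.-1.*2.+1)%N by lia.
move/(congr1 im); rewrite exprS y_double imM re_y im_y re_io mul0r add0r mul1r.
by rewrite -(rmorph0 io) im_io => xl0; have := chain_nil_min xl; rewrite xl0 eqxx.
Qed.

Lemma decomp_ex v :
  exists p : 'I_(l.*2).+1 * V, primitive p.2 && (v == y ^+ p.1 *: p.2).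
Proof.
have [i [w [il pw vw]]] := primitive_decomp v.
by exists (Ordinal (il : (i < (l.*2).+1)%N), w); rewrite pw vw /= eqxx.
Qed.

Definition decomp v := xchoose (decomp_ex v).

(* Multiplication by x^(i/2) retains exactly the class of the norm modulo x^(l - i/2). *)
Definition orbit_invariant v : 'I_(l.*2).+1 * R :=
  let: (i, w) := decomp v in (i, x ^+ i./2 * norm w).

(** Independence of the chosen decomposition: two decompositions of one vector are conjugate under
    the identity. *)
Lemma orbit_invariantE (i : 'I_(l.*2).+1) w :
  primitive w -> orbit_invariant (y ^+ i *: w) = (i, x ^+ i./2 * norm w).
Proof.
move=> pw; rewrite /orbit_invariant.
have := xchooseP (decomp_ex (y ^+ i *: w)); rewrite -/(decomp _).
case: (decomp _) => k u /= /andP[pu /eqP yiw].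
have ik : i = k.
  have il := ltn_ord i; have kl := ltn_ord k; rewrite !ltnS in il kl.
  by apply/val_inj/(layer_unique il kl pw pu); rewrite /= yiw; apply: conjugate_refl.
rewrite -{k}ik in yiw *; congr (_, _).
have [il|li] := ltnP i (l.*2).
  by apply/(conjugate_layer il) => //; rewrite yiw; apply: conjugate_refl.
have -> : nat_of_ord i = l.*2 by apply/anti_leq; rewrite li -ltnS ltn_ord.
by rewrite doubleK (chain_nil xl) !mul0r.
Qed.

Lemma conjugate_invariant u v :
  isoconj u v <-> orbit_invariant u = orbit_invariant v.
Proof.
have [i [w [il pw ->]]] := primitive_decomp u.
have [k [z [kl pz ->]]] := primitive_decomp v.
have iE := @orbit_invariantE (Ordinal (il : (i < (l.*2).+1)%N)) _ pw.
have kE := @orbit_invariantE (Ordinal (kl : (k < (l.*2).+1)%N)) _ pz.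
rewrite /= in iE kE; rewrite iE kE; split => [c|[ik]].
  have ik := layer_unique il kl pw pz c; subst k; congr (_, _); first exact: val_inj.
  have [il'|li] := ltnP i (l.*2); first exact/(conjugate_layer il').
  have -> : i = l.*2 by apply/anti_leq; rewrite il li.
  by rewrite doubleK (chain_nil xl) !mul0r.
subst k => e; have [il'|li] := ltnP i (l.*2); first exact/(conjugate_layer il').
have -> : i = l.*2 by apply/anti_leq; rewrite il li.
by rewrite y_nil !scale0r; apply: conjugate_refl.
Qed.

Definition primitive_norms : {set R} := [set norm w | w : V & primitive w].

Lemma primitive_normsP r :
  reflect (exists2 w, primitive w & norm w = r) (r \in primitive_norms).
Proof.
by apply: (iffP imsetP) => [[w /[!inE] pw ->]|[w pw <-]]; exists w; rewrite ?inE.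
Qed.

Lemma card_orbit_invariant :
  #|orbit_invariant @: [set: V]| =
  (2 * (\sum_(j < l) #|[set (x ^+ j * s)%R | s in primitive_norms]|) + 1)%N.
Proof.
pose E := orbit_invariant @: [set: V].
pose L (i : nat) := [set x ^+ i./2 * s | s in primitive_norms].
have LE (i : 'I_(l.*2).+1) : #|[set r | (i, r) \in E]| = #|L i|.
  apply: eq_card => r; rewrite inE.
  apply/imsetP/imsetP => [[v _]|[_ /primitive_normsP[w pw <-] ->]].
    have [k [w [kl pw ->]]] := primitive_decomp v.
    have := @orbit_invariantE (Ordinal (kl : (k < (l.*2).+1)%N)) _ pw.
    rewrite /= => -> [-> ->]; exists (norm w) => //; apply/primitive_normsP.
    by exists w.
  by exists (y ^+ i *: w) => //; rewrite orbit_invariantE.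
have -> : #|E| = (\sum_(i < (l.*2).+1) #|L i|)%N.
  under eq_bigr do rewrite -LE.
  rewrite -sum1_card; under [RHS]eq_bigr do rewrite -sum1_card.
  rewrite pair_big_dep /=; apply: eq_bigl => -[i r] /=; by rewrite !inE.
rewrite big_ord_recr /=; congr (_ + _)%N; last first.
  apply/eqP/cards1P; exists 0; apply/setP => r; rewrite in_set1 /L doubleK.
  apply/imsetP/eqP => [[s _ ->]|->]; first by rewrite (chain_nil xl) mul0r.
  have [w pw] := primitive_exists.
  by exists (norm w); rewrite ?(chain_nil xl) ?mul0r //; apply/primitive_normsP; exists w.
rewrite /L; elim: (l) => [|k IH]; first by rewrite !big_ord0.
rewrite doubleS !big_ord_recr /= IH mulnDr -addnA; congr (_ + _)%N.
by rewrite /= uphalf_double doubleK mul2n addnn.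
Qed.

(** * Orthogonal bases and the semilinear map *)

Definition frame k (b : 'I_k -> V) : Prop :=
  [/\ forall i j, i != j -> h (b i) (b j) = 0,
      forall i, norm (b i) \is a GRing.unit &
      forall v, v = \sum_i (io (norm (b i))^-1 * h (b i) v) *: b i].

(** For orthogonal b with unit norms, the projection onto the orthogonal complement of b. *)
Definition residual k (b : 'I_k -> V) v :=
  v - \sum_i (io (norm (b i))^-1 * h (b i) v) *: b i.

Lemma residualZ k (b : 'I_k -> V) a v : residual b (a *: v) = a *: residual b v.
Proof.
rewrite /residual scalerBr scaler_sumr; congr (_ - _); apply: eq_bigr => i _.
by rewrite hZr scalerA mulrCA.
Qed.

Section Orthogonal.
Variables (k : nat) (b : 'I_k -> V).
Hypothesis b_orth : forall i j, i != j -> h (b i) (b j) = 0.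
Hypothesis b_unit : forall i, norm (b i) \is a GRing.unit.

Lemma residual_orth i v : h (b i) (residual b v) = 0.
Proof.
rewrite hBr h_sumr (bigD1 i) //= big1 => [|j ji]; last first.
  by rewrite hZr b_orth ?mulr0 // eq_sym.
by rewrite hZr h_norm mulrAC -rmorphM mulVr // rmorph1 mul1r addr0 subrr.
Qed.

Lemma residual_dual u v : (forall i, h (b i) u = 0) -> h u (residual b v) = h u v.
Proof.
move=> bu; rewrite hBr h_sumr big1 ?subr0 // => i _.
by rewrite hZr [h u _]hS bu star0 mulr0.
Qed.

Lemma residual_id u : (forall i, h (b i) u = 0) -> residual b u = u.
Proof.
by move=> bu; rewrite /residual big1 ?subr0 // => i _; rewrite bu mulr0 scale0r.
Qed.

(* The orthogonal complement contains a primitive vector, so the form takes a unit value there;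
   by polarization, so does the norm. *)
Lemma orthogonal_extend v : residual b v != 0 ->
  exists2 u, (forall i, h (b i) u = 0) & norm u \is a GRing.unit.
Proof.
set u := residual b v => u0; have bu i : h (b i) u = 0 by apply: residual_orth.
have [i [w [il pw uw]]] := primitive_decomp u.
have {}il : (i < l.*2)%N.
  rewrite ltn_neqAle il andbT; apply: contra u0 => /eqP il'.
  by rewrite uw il' y_nil scale0r.
(* Though y^i w is orthogonal to b, w need not be. Its residual differs from it by an element of
   y^(2l - i) V with 2l - i > 0, and so stays primitive. *)
have [|z wz] := @ann_V i (residual b w - w) (ltnW il).
  by rewrite scalerBr -residualZ -uw residual_id // uw subrr.
have /primitiveP[z' uz'] : primitive (residual b w).
  case/existsP: (pw) => z' /eqP wz'; apply/primitiveP; exists z'.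
  rewrite -[residual b w](subrK w) wz hDl wz' addrC reD re1 hZl starX star_y.
  have -> : (l.*2 - i = (l.*2 - i).-1.+1)%N by lia.
  apply: (unitD_nonunit xl (unitr1 _)).
  by rewrite exprS -mulrA mulNr -mulrN re_mulyn.
have bw j : h (b j) (residual b w) = 0 by apply: residual_orth.
rewrite -(residual_dual z' bw) in uz'.
have bz' j : h (b j) (residual b z') = 0 by apply: residual_orth.
have [nw|nw] := boolP (norm (residual b w) \is a GRing.unit); first by exists (residual b w).
have [nz|nz] := boolP (norm (residual b z') \is a GRing.unit); first by exists (residual b z').
exists (residual b w + residual b z') => [j|]; first by rewrite hDr bw bz' addr0.
rewrite normD addrC; apply: (unitD_nonunit xl); first by rewrite unitrM (chain_unit2 xl).
apply: contra nw => nwz; rewrite -(addrK (norm (residual b z')) (norm (residual b w))).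
by apply: (unitD_nonunit xl); rewrite ?unitrN.
Qed.

End Orthogonal.

(** Gram-Schmidt, by induction on the size of the orthogonal complement, which shrinks because the
    new vector is not orthogonal to itself. *)
Lemma frame_exists : exists k (b : 'I_k -> V), frame b.
Proof.
suff H m k (b : 'I_k -> V) :
    (forall i j, i != j -> h (b i) (b j) = 0) ->
    (forall i, norm (b i) \is a GRing.unit) ->
    (#|[set v | [forall i, (h (b i) v == 0)%R]]| < m)%N ->
    exists k (b : 'I_k -> V), frame b.
  by apply: (H _ 0%N (fun=> 0)) => [[]|[]|] //; apply: ltnSn.
elim: m k b => // m IH k b b_orth b_unit bm.
have [/forallP res0|] := boolP [forall v, residual b v == 0].
  by exists k, b; split => // v; apply/eqP; rewrite -subr_eq0; apply: res0.
rewrite negb_forall => /existsP[v /(orthogonal_extend b_orth b_unit)[u bu uu]].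
pose b' i := if unlift ord0 i is Some j then b j else u.
apply: (IH _ b') => [i j|i|].
- rewrite /b'; case: unliftP => [i' ->|->]; case: unliftP => [j' ->|->] //.
  + by rewrite (inj_eq lift_inj) => /b_orth.
  + by rewrite hS bu star0.
- by rewrite /b'; case: unliftP.
apply: leq_trans (proper_card _) bm; apply/properP; split.
  apply/subsetP => w /[!inE] /forallP bw; apply/forallP => i.
  by have := bw (lift ord0 i); rewrite /b' liftK.
exists u; rewrite !inE; first by apply/forallP => i; rewrite bu.
apply/negP => /forallP/(_ ord0); rewrite /b' unlift_none h_norm => /eqP/(congr1 re).
by rewrite re_io -(rmorph0 io) re_io => nu; rewrite nu unitr0 in uu.
Qed.

Section Semilinear.
Variables (k : nat) (b : 'I_k -> V).
Hypothesis bF : frame b.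

(** Applies [star] to the coordinates of v in the basis b. *)
Definition frame_conj v : V := \sum_i (io (norm (b i))^-1 * h v (b i)) *: b i.

Lemma frame_conjD u v : frame_conj (u + v) = frame_conj u + frame_conj v.
Proof.
by rewrite -big_split; apply: eq_bigr => i _; rewrite hDl mulrDr scalerDl.
Qed.

Lemma frame_conjZ a v : frame_conj (a *: v) = star a *: frame_conj v.
Proof.
by rewrite scaler_sumr; apply: eq_bigr => i _; rewrite hZl mulrCA scalerA.
Qed.

Lemma h_frame_conj u v : h (frame_conj u) (frame_conj v) = h v u.
Proof.
have [b_orth b_unit bE] := bF.
rewrite [in RHS](bE u) [RHS]h_sumr [LHS]h_suml; apply: eq_bigr => i _.
rewrite h_sumr (bigD1 i) //= big1 ?addr0 => [|j ji]; last first.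
  by rewrite hZl hZr b_orth 1?eq_sym // !mulr0.
rewrite hZl !hZr starM star_io -hS h_norm; congr (_ * _).
by rewrite mulrAC -rmorphM mulVr // rmorph1 mul1r.
Qed.

(** For v = y^i w, Witt's theorem applies to w and its image, which have the same norm; the sign
    (-1)^i from [star] is absorbed by the isometry -1. *)
Lemma conjugate_frame_conj v : isoconj v (frame_conj v).
Proof.
have [i [w [il pw ->]]] := primitive_decomp v.
rewrite frame_conjZ starX star_y exprNn -scalerA.
apply: (@conjugate_trans (y ^+ i *: frame_conj w)).
  apply/conjugateZ/witt_primitive => //; last by rewrite /norm h_frame_conj.
  case/existsP: pw => z /eqP wz; apply/existsP; exists (frame_conj z).
  by rewrite h_frame_conj hS wz star1.
rewrite -signr_odd; case: odd; last by rewrite scale1r; apply: conjugate_refl.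
by rewrite scaleN1r; apply/conjugate_sym/conjugateN.
Qed.

End Semilinear.

(* Combining the semilinear map of a frame with an isometry that brings its value at v
   back to v. *)
Lemma orbit_reversing v : exists2 r : V -> V, injective r &
  [/\ forall u w, r (u + w) = r u + r w, r v = v, forall u, isoconj u (r u) &
      forall u, h (r u) v = star (h u v)].
Proof.
have [k [b bF]] := frame_exists.
have [g gI vg] := conjugate_sym (conjugate_frame_conj bF v).
have [gD gZ gh] := gI; exists (fun u => g (frame_conj b u)).
  move=> u w /perm_inj uw; apply/eqP; rewrite -subr_eq0; apply/eqP/h_inj => z.
  by rewrite hBl -!(h_frame_conj bF z) uw subrr.
split=> [u w||u|u]; rewrite ?frame_conjD ?gD //.
  by apply: conjugate_trans (conjugate_frame_conj bF u) _; exists g.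
by rewrite -[X in h _ X]vg gh (h_frame_conj bF) hS.
Qed.

(** * The set of norms of primitive vectors *)

Section PrimitiveNorms.
Variables (F : finFieldType) (pi : {rmorphism R -> F}).
Hypothesis pi_surj : forall c : F, exists r, pi r = c.
Hypothesis pi_ker : forall r, pi r = 0 <-> exists s, r = x * s.

(** Thus [primitive_norms] is a union of cosets of the maximal ideal, and norms need only be found
    modulo x. *)
Lemma primitive_norms_lift w t : primitive w -> (exists c : R, norm w = t + x * c) ->
  t \in primitive_norms.
Proof.
move=> pw [c wt]; have [s [z [pw' nw']]] := @norm_adjust w 1 (- c) isT pw.
apply/primitive_normsP; exists (w + io (x ^+ 1 * s) *: z) => //.
by rewrite nw' wt expr1; ring.
Qed.

Lemma norm_diag2 u w (s t : R) : h u w = 0 ->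
  norm (io s *: u + io t *: w) = norm u * s ^+ 2 + norm w * t ^+ 2.
Proof.
move=> uw; rewrite normD !normZ hZl hZr uw !mulr0 !re_io !im_io -(rmorph0 io) re_io.
ring.
Qed.

(** The binary form on u, v represents t - norm w modulo x; the coefficient 1 of w guarantees
    primitivity even if t is a non-unit. *)
Lemma norms_universal3 u v w :
  h u v = 0 -> h u w = 0 -> h v w = 0 ->
  norm u \is a GRing.unit -> norm v \is a GRing.unit -> norm w \is a GRing.unit ->
  primitive_norms = setT.
Proof.
move=> uv uw vw nu nv nw; apply/setP => t; rewrite [RHS]inE.
have [s [s' [e E]]] := diag_form_universal xl pi_surj pi_ker (t - norm w) nu nv.
pose z := io s *: u + io s' *: v + w.
have zw : h z w = io (norm w) by rewrite !hDl !hZl uw vw !mulr0 !add0r h_norm.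
apply: (@primitive_norms_lift z).
  by apply/primitiveP; exists w; rewrite zw re_io.
exists e; rewrite normD norm_diag2 // E hDl !hZl uw vw !mulr0 addr0.
by rewrite -(rmorph0 io) re_io; ring.
Qed.

Lemma norms_hyperbolic u w :
  h u w = 0 -> norm u = 1 -> norm w = -1 -> primitive_norms = setT.
Proof.
move=> uw nu nw; apply/setP => t; rewrite [RHS]inE; apply/primitive_normsP.
(* Chosen so that a - b = 1 and a + b = t: then a^2 - b^2 = t, and pairing with u + w gives a - b =
   1, whence primitivity. *)
have u2 := chain_unit2 xl; pose a := (t + 1) / 2; pose b := (t - 1) / 2.
have ab : a - b = 1.
  by rewrite /a /b -mulrBl (_ : t + 1 - (t - 1) = 2) ?divrr //; ring.
have abt : a + b = t.
  by rewrite /a /b -mulrDl (_ : t + 1 + (t - 1) = t * 2) ?mulrK //; ring.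
exists (io a *: u + io b *: w).
  apply/primitiveP; exists (u + w); have wu : h w u = 0 by rewrite hS uw star0.
  rewrite hDl !hDr !hZl uw wu !mulr0 addr0 add0r !star_io !h_norm nu nw.
  by rewrite -!rmorphM -rmorphD re_io mulrN !mulr1 ab unitr1.
rewrite norm_diag2 // nu nw (_ : 1 * a ^+ 2 + -1 * b ^+ 2 = (a - b) * (a + b)); last by ring.
by rewrite ab mul1r.
Qed.

Lemma primitive_combination k (b : 'I_k -> V) (c : 'I_k -> A) :
  primitive (\sum_i c i *: b i) -> exists i, re (c i) \is a GRing.unit.
Proof.
case/primitiveP => z; rewrite h_suml => uz; apply/existsP; apply: contraTT uz.
rewrite negb_exists => /forallP nc.
elim/big_ind: _ => [|a a' na na'|i _].
- by rewrite -(rmorph0 io) re_io unitr0.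
- rewrite reD; apply: contra na => ua; rewrite -(addrK (re a') (re a)).
  by apply: (unitD_nonunit xl); rewrite ?unitrN.
by rewrite hZl re_unitM re_star negb_and nc.
Qed.

Lemma unit_square_lift (r s e : R) : r \is a GRing.unit -> r = s ^+ 2 + x * e ->
  exists2 t, t \is a GRing.unit & r = t ^+ 2.
Proof.
move=> ur re_s.
have us : s \is a GRing.unit.
  rewrite -(unitrX_pos s (n := 2)) //.
  by rewrite (_ : s ^+ 2 = r + x * - e); [apply: (unitDx xl) | rewrite re_s; ring].
(* Since (1 + x t)^2 = 1 + x (2 t + x t^2), the bracket must equal e / s^2. *)
have [t tE] := hensel_quadratic xl 1 (e / s ^+ 2).
exists (s * (1 + x * t)); first by rewrite unitrM us; apply: (unitDx xl _ (unitr1 _)).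
have es : e = (2 * t + x * 1 * t ^+ 2) * s ^+ 2 by rewrite tE divrK // unitrX.
by rewrite re_s es; ring.
Qed.

(** A primitive vector with non-unit norm would give (re a)^2 congruent to eps (re d)^2 modulo x
    with re a or re d a unit. Then re d is a unit, and eps is a square modulo x, hence a square.
    Conversely, a vector of unit norm is automatically primitive. *)
Lemma norms_anisotropic (b : 'I_2 -> V) eps :
  (forall v, exists c : 'I_2 -> A, v = \sum_i c i *: b i) ->
  h (b ord0) (b ord_max) = 0 -> norm (b ord0) = 1 -> norm (b ord_max) = - eps ->
  eps \is a GRing.unit -> (~ exists2 r, r \is a GRing.unit & eps = r ^+ 2) ->
  primitive_norms = [set u | u \is a GRing.unit].
Proof.
move=> bE b01 n0 n1 ueps nsq; apply/setP => t; rewrite inE.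
apply/idP/idP => [/primitive_normsP[w pw <-]|ut]; last first.
  have ub0 : norm (b ord0) \is a GRing.unit by rewrite n0 unitr1.
  have ub1 : norm (b ord_max) \is a GRing.unit by rewrite n1 unitrN.
  have [s [s' [e E]]] := diag_form_universal xl pi_surj pi_ker t ub0 ub1.
  pose z := io s *: b ord0 + io s' *: b ord_max.
  have nz : norm z = t + x * e by rewrite norm_diag2.
  apply: (@primitive_norms_lift z); last by exists e.
  by apply/primitiveP; exists z; rewrite -/(norm z) nz; apply: (unitDx xl).
have [c cE] := bE w; have := pw; rewrite {1}cE => /primitive_combination[i ci].
apply: contraPT nsq => nw; case; move: nw.
have {cE} -> : w = c ord0 *: b ord0 + c ord_max *: b ord_max.
  by rewrite cE big_ord_recl big_ord1; congr (_ + c _ *: b _); apply: val_inj.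
set a := c ord0; set d := c ord_max.
rewrite normD !normZ hZl hZr b01 !mulr0 -(rmorph0 io) re_io n0 n1 => /(chain_nonunit xl)[f].
move=> fE; have {}fE : re a ^+ 2 = eps * re d ^+ 2 + x * (f + im a ^+ 2 - eps * im d ^+ 2).
  by rewrite !mulrDr -fE; ring.
have [ud|nd] := boolP (re d \is a GRing.unit); last first.
  have [g gE] := chain_nonunit xl nd.
  have ua : re a \isn't a GRing.unit.
    have e : re a ^+ 2 = x * (eps * (x * g ^+ 2) + (f + im a ^+ 2 - eps * im d ^+ 2)).
      by rewrite fE gE; ring.
    by rewrite -(unitrX_pos (re a) (n := 2)) // e (mulx_nonunit xl).
  case: (i =P ord0) ci => [->|i0]; first by rewrite -/a (negPf ua).
  have -> : i = ord_max by case: i i0 => [[|[|//]] i2] i0; [case: i0|]; apply: val_inj.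
  by rewrite -/d (negPf nd).
apply: (@unit_square_lift _ (re a / re d) (- (f + im a ^+ 2 - eps * im d ^+ 2) / re d ^+ 2)) => //.
have dd : re d ^+ 2 * (re d ^+ 2)^-1 = 1 by rewrite divrr ?unitrX.
rewrite exprMn exprVn fE; move: (_^-1) dd => D dd.
by rewrite -[LHS]mulr1 -dd; ring.
Qed.

(** The norms of units of A are exactly the squares of units of R, by [unit_square_lift]. *)
Lemma norms_rank1 (b : V) : (forall v, exists c, v = c *: b) ->
  exists2 n0, n0 \is a GRing.unit &
    primitive_norms = [set n0 * u ^+ 2 | u : R & u \is a GRing.unit].
Proof.
move=> bE.
have b_prim c : primitive (c *: b) -> re c \is a GRing.unit.
  by case/primitiveP => z; rewrite hZl re_unitM re_star => /andP[].
have [w0 pw0] := primitive_exists.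
have ub : norm b \is a GRing.unit.
  have [c cE] := bE w0; move: pw0; rewrite cE => /primitiveP[z].
  have [d ->] := bE z; rewrite hZl hZr !re_unitM => /andP[_ /andP[]].
  by rewrite h_norm re_io.
exists (norm b) => //; apply/setP => t; apply/primitive_normsP/imsetP.
  move=> [w pw <-]; have [c cE] := bE w; move: pw; rewrite cE => /b_prim uc.
  have [||u uu cu] := @unit_square_lift (re c ^+ 2 - x * im c ^+ 2) (re c) (- im c ^+ 2).
  - by rewrite -mulrN; apply: (unitDx xl); rewrite unitrX.
  - by rewrite mulrN.
  by exists u; rewrite ?inE // normZ cu mulrC.
move=> [u /[!inE] uu ->]; exists (io u *: b); last first.
  by rewrite normZ re_io im_io; ring.
by apply/primitiveP; exists b; rewrite hZl star_io h_norm -rmorphM re_io unitrM uu.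
Qed.

End PrimitiveNorms.

End Hermitian.
End RamifiedExt.

(** * Heisenberg operators *)

Section WeilCommutant.
(** In the application chi u v is mu (h u v), an alternating bicharacter, and L is the subgroup iV,
    on which it is trivial. *)
Variables (V : finZmodType) (C : closedFieldType) (chi : V -> V -> C).
Hypothesis char0 : [pchar C] =i pred0.
Hypothesis chiDl : forall u u' v, chi (u + u') v = chi u v * chi u' v.
Hypothesis chiDr : forall u v v', chi u (v + v') = chi u v * chi u v'.
Hypothesis chiV : forall u v, chi u v * chi v u = 1.
Hypothesis chi_diag : forall v, chi v v = 1.
Hypothesis chi_nondeg : forall u, (forall w, chi u w ^+ 2 = 1) -> u = 0.

Variables (L T : {set V}).
Hypothesis L_add : forall z z', z \in L -> z' \in L -> z + z' \in L.
Hypothesis L_opp : forall z, z \in L -> - z \in L.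
Hypothesis chi_L : forall z z', z \in L -> z' \in L -> chi z z' = 1.
Hypothesis T_trans : forall v, exists! t, t \in T /\ v - t \in L.
Hypothesis T_card : (#|T| * #|T| <= #|V|)%N.

Variables (G : {group {perm V}}) (rG : mx_representation C G #|T|).
Hypothesis G_add : forall g, g \in G -> forall u v, g (u + v) = g u + g v.
Hypothesis G_chi : forall g, g \in G -> forall u v, chi (g u) (g v) = chi u v.
Hypothesis G_L : forall g, g \in G -> forall z, z \in L -> g z \in L.
Hypothesis rGE : forall g i j, g \in G ->
  rG g i j = if g (enum_val i) - enum_val j \in L
             then chi (g (enum_val i)) (enum_val j) else 0.
Hypothesis reversing : forall v, exists2 r : V -> V, injective r &
  [/\ forall u w, r (u + w) = r u + r w, r v = v,
      forall u, orbit 'P G (r u) = orbit 'P G u & forall u, chi (r u) v = chi v u].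

Let N := #|T|.
Local Notation tv i := (@enum_val V (mem T) i).

Lemma chi0l v : chi 0 v = 1.
Proof.
have chi_neq0 : chi 0 v != 0.
  by apply/eqP => e; have := chiV 0 v; rewrite e mul0r => /eqP; rewrite eq_sym oner_eq0.
by apply: (mulfI chi_neq0); rewrite -chiDl addr0 mulr1.
Qed.

Lemma chiNl u v : chi (- u) v = chi v u.
Proof.
have /mulfI : chi u v != 0.
  by apply/eqP => e; have := chiV u v; rewrite e mul0r => /eqP; rewrite eq_sym oner_eq0.
by apply; rewrite -chiDl subrr chi0l chiV.
Qed.

Lemma chiBl u u' v : chi (u - u') v = chi u v * chi v u'.
Proof. by rewrite chiDl chiNl. Qed.

Lemma L0 : 0 \in L.
Proof.
by have [t [[_ tL] _]] := T_trans 0; rewrite -(subrr (0 - t)) L_add // L_opp.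
Qed.

Lemma transversal_idx : exists idx : V -> 'I_N,
  forall v i, (v - tv i \in L) = (i == idx v).
Proof.
suff /fin_all_exists H v : exists k : 'I_N, forall i, (v - tv i \in L) = (i == k) by [].
have [t [[tT tL] tU]] := T_trans v; exists (enum_rank_in tT t) => i; apply/idP/eqP => [vi|->].
  by apply: enum_val_inj; rewrite enum_rankK_in // (tU _ (conj (enum_valP i) vi)).
by rewrite enum_rankK_in.
Qed.

Section Operators.
Variable idx : V -> 'I_N.
Hypothesis idxP : forall v i, (v - tv i \in L) = (i == idx v).

(** e_v for every v in V, by the rule e_v = mu (h v t) e_t with t the representative of v. In these
    terms g e_v = e_(g v), without cocycle. *)
Definition wvec v : 'rV[C]_N := chi v (tv (idx v)) *: delta_mx 0 (idx v).

Definition heis u : 'M[C]_N := \matrix_(i, j) (chi u (tv i) *: wvec (u + tv i)) 0 j.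

Lemma sub_idx v : v - tv (idx v) \in L.
Proof. by rewrite idxP. Qed.

Lemma idx_enum i : idx (tv i) = i.
Proof. by apply/esym/eqP; rewrite -idxP subrr L0. Qed.

Lemma wvec_enum i : wvec (tv i) = delta_mx 0 i.
Proof. by rewrite /wvec idx_enum chi_diag scale1r. Qed.

Lemma wvecD v z : z \in L -> wvec (v + z) = chi z v *: wvec v.
Proof.
move=> zL; rewrite /wvec; have -> : idx (v + z) = idx v.
  by apply/esym/eqP; rewrite -idxP addrAC L_add ?sub_idx.
rewrite scalerA; congr (_ *: _); rewrite chiDl mulrC; congr (_ * _).
by have := chiDr z (v - tv (idx v)) (tv (idx v)); rewrite subrK (chi_L zL (sub_idx v)) mul1r.
Qed.

Lemma wvecE v : wvec v = chi (v - tv (idx v)) (tv (idx v)) *: wvec (tv (idx v)).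
Proof. by rewrite -wvecD ?sub_idx // addrC subrK. Qed.

Lemma wvec_inj (A B : 'M[C]_N) : (forall v, wvec v *m A = wvec v *m B) -> A = B.
Proof. by move=> AB; apply/row_matrixP => i; rewrite !rowE -wvec_enum. Qed.

Lemma wvec_rG g v : g \in G -> wvec v *m rG g = wvec (g v).
Proof.
move=> gG; rewrite wvecE -scalemxAl; set t := tv (idx v).
have -> : wvec t *m rG g = wvec (g t).
  rewrite wvec_enum -rowE; apply/rowP => j; rewrite !mxE rGE // idxP eqxx /=.
  by case: eqVneq => [->|_]; rewrite ?mulr1 ?mulr0.
have gv : g v = g t + g (v - t) by rewrite -G_add // addrC subrK.
by rewrite gv wvecD ?G_chi // G_L // sub_idx.
Qed.

Lemma wvec_heis u v : wvec v *m heis u = chi u v *: wvec (u + v).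
Proof.
rewrite wvecE -scalemxAl; set t := tv (idx v).
have -> : wvec t *m heis u = chi u t *: wvec (u + t).
  by rewrite wvec_enum -rowE; apply/rowP => j; rewrite !mxE.
have vt : v = t + (v - t) by rewrite addrC subrK.
have zL : v - t \in L by apply: sub_idx.
move: (v - t) vt zL => z -> zL; rewrite addrA (wvecD _ zL) [LHS]scalerA [RHS]scalerA.
rewrite !chiDr; congr (_ *: _).
have -> : chi u t * chi u z * (chi z u * chi z t) =
  chi u z * chi z u * (chi z t * chi u t) by ring.
by rewrite chiV mul1r.
Qed.

Lemma heisM u w : heis w *m heis u = chi u w *: heis (u + w).
Proof.
apply: wvec_inj => v; rewrite mulmxA -scalemxAr !wvec_heis -scalemxAl wvec_heis.
rewrite [LHS]scalerA [RHS]scalerA chiDr chiDl addrA; congr (_ *: _); ring.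
Qed.

Lemma heis0 : heis 0 = 1%:M.
Proof. by apply: wvec_inj => v; rewrite wvec_heis chi0l scale1r add0r mulmx1. Qed.

Lemma heis_rG g u : g \in G -> heis u *m rG g = rG g *m heis (g u).
Proof.
move=> gG; apply: wvec_inj => v; rewrite !mulmxA wvec_heis -scalemxAl !wvec_rG //.
by rewrite wvec_heis G_chi // G_add.
Qed.

(* Conjugation by heis w multiplies heis u by chi u w ^ 2, so the trace of heis u vanishes
   unless this factor is 1 for all w. *)
Lemma mxtrace_heis u : u != 0 -> \tr (heis u) = 0.
Proof.
move=> u0; apply/eqP; apply: contraNT u0 => tr0; apply/eqP/chi_nondeg => w.
apply: (mulIf tr0); rewrite mul1r -[in RHS](mul1mx (heis u)) -heis0.
have -> : heis 0 = heis (- w) *m heis w.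
  rewrite heisM subrr; have := chiV w (- w); rewrite chiNl chi_diag mulr1 => ->.
  by rewrite scale1r.
rewrite -mulmxA [heis w *m _]heisM [u + w]addrC.
have <- : chi u w *: (heis u *m heis w) = heis (w + u).
  by rewrite heisM scalerA chiV scale1r.
rewrite scalerA -expr2 -scalemxAr mxtraceZ; congr (_ * _).
rewrite mxtrace_mulC -mulmxA.
have -> : heis w *m heis (- w) = 1%:M; last by rewrite mulmx1.
by rewrite heisM addNr chiNl chi_diag heis0 scale1r.
Qed.

Lemma card_T_neq0 : (N%:R : C) != 0.
Proof.
have /pcharf0P -> := char0; rewrite -lt0n; have [t [[tT _] _]] := T_trans 0.
by apply/card_gt0P; exists t.
Qed.

(** The trace against [heis (- u)] isolates N times the coefficient of [heis u]. *)
Lemma heis_free (c : V -> C) : \sum_v c v *: heis v = 0 -> forall v, c v = 0.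
Proof.
move=> c0 u; apply: (mulIf card_T_neq0); rewrite mul0r.
have := congr1 (fun M => \tr (M *m heis (- u))) c0.
rewrite mul0mx mxtrace0 mulmx_suml raddf_sum (bigD1 u) //= big1 => [|v vu].
  rewrite addr0 -scalemxAl heisM addNr chiNl chi_diag heis0 scale1r mxtraceZ.
  by rewrite mxtrace1.
rewrite -scalemxAl heisM !mxtraceZ mxtrace_heis ?mulr0 //.
by rewrite addrC subr_eq0.
Qed.

(** These are |V| independent elements of a space of dimension N^2, at most |V|. *)
Lemma heis_span (M : 'M[C]_N) : exists c : V -> C, M = \sum_v c v *: heis v.
Proof.
pose H := \matrix_(i < #|V|) mxvec (heis (enum_val i)).
have HE (c : 'rV_#|V|) : vec_mx (c *m H) = \sum_v c 0 (enum_rank v) *: heis v.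
  rewrite mulmx_sum_row linear_sum (reindex (@enum_rank V)) /=; last first.
    by exists enum_val => i _; rewrite ?enum_rankK ?enum_valK.
  by apply: eq_bigr => v _; rewrite linearZ /= rowK mxvecK enum_rankK.
have Hfree : row_free H.
  apply: inj_row_free => c cH; have := HE c; rewrite cH linear0 => /esym/heis_free c0.
  by apply/rowP => i; rewrite mxE -(enum_valK i) c0.
have Hfull : row_full H.
  by rewrite /row_full eqn_leq rank_leq_col (eqP Hfree) T_card.
have /submxP[c cM] := submx_full (mxvec M) Hfull.
by exists (fun v => c 0 (enum_rank v)); rewrite -HE -cM mxvecK.
Qed.

(** * Orbit sums and the commutant *)

Local Notation orbits := {O : {set V} | O \in orbit 'P G @: [set: V]}.

Definition orb v : orbits := exist _ (orbit 'P G v) (imset_f _ (in_setT v)).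

Lemma orb_eq u v : orbit 'P G u = orbit 'P G v -> orb u = orb v.
Proof. by move=> uv; apply: val_inj. Qed.

Lemma orb_act g v : g \in G -> orb (g v) = orb v.
Proof. by move=> gG; apply/orb_eq/(orbit_act 'P v gG). Qed.

Definition orbit_sum (O : orbits) : 'M[C]_N := \sum_(v | orb v == O) heis v.

Lemma orbit_sum_comb (c : orbits -> C) :
  \sum_O c O *: orbit_sum O = \sum_v c (orb v) *: heis v.
Proof.
rewrite (partition_big orb xpredT) //=; apply: eq_bigr => O _.
by rewrite scaler_sumr; apply: eq_bigr => v /eqP ->.
Qed.

Lemma sum_heis_rG (c : V -> C) g : g \in G ->
  (\sum_v c v *: heis v) *m rG g = rG g *m \sum_v c v *: heis (g v).
Proof.
move=> gG; rewrite mulmx_suml mulmx_sumr; apply: eq_bigr => v _.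
by rewrite -scalemxAl -scalemxAr heis_rG.
Qed.

Lemma sum_heis_inj (c d : V -> C) :
  \sum_v c v *: heis v = \sum_v d v *: heis v -> c =1 d.
Proof.
move=> cd v; apply/eqP; rewrite -subr_eq0; apply/eqP.
apply: (@heis_free (fun v => c v - d v)).
by under eq_bigr do rewrite scalerBl; rewrite sumrB cd subrr.
Qed.

Lemma orbit_sum_cent O : centgmx rG (orbit_sum O).
Proof.
apply/centgmxP => g gG.
have -> : orbit_sum O = \sum_v (orb v == O)%:R *: heis v.
  rewrite /orbit_sum big_mkcond; apply: eq_bigr => v _.
  by case: ifP => _; rewrite ?scale1r ?scale0r.
rewrite sum_heis_rG //; congr (_ *m _); rewrite [RHS](reindex_inj (@perm_inj _ g)).
by apply: eq_bigr => v _; rewrite orb_act.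
Qed.

Lemma cent_orbit_sum f : centgmx rG f -> exists c, f = \sum_O c O *: orbit_sum O.
Proof.
have [c ->] := heis_span f => /centgmxP cf.
have cG g v : g \in G -> c (g v) = c v.
  move=> gG; have := cf g gG; rewrite sum_heis_rG // => /(congr1 (mulmx (rG g^-1%g))).
  rewrite !mulmxA -repr_mxM ?groupV // mulVg repr_mx1 !mul1mx.
  rewrite [RHS](reindex_inj (@perm_inj _ g)) => e.
  have {}e : \sum_w c ((g^-1)%g w) *: heis w = \sum_w c w *: heis w.
    rewrite [LHS](reindex_inj (@perm_inj _ g)) [RHS](reindex_inj (@perm_inj _ g)) /= -e.
    by apply: eq_bigr => w _; rewrite permK.
  by have /= := sum_heis_inj e (g v); rewrite permK.
(* The common value of c on the orbit O; every O is the orbit of some vector, so the default 0 is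
   never taken. *)
exists (fun O : orbits => if [pick v | orb v == O] is Some v then c v else 0).
rewrite orbit_sum_comb; apply: eq_bigr => v _; congr (_ *: _).
case: pickP => [w /eqP wv|/(_ v)]; last by rewrite eqxx.
have /orbitP[g gG <-] : w \in orbit 'P G v.
  by rewrite -[orbit _ _ v](congr1 val wv) orbit_refl.
by rewrite cG.
Qed.

(** The coefficient of [heis v] in a product is a sum of chi u v over the u with u and v - u in
    prescribed orbits. Substituting r u for u in one product, with r fixing v, and v - u for u in
    the other turns both into the same sum of chi v u. *)
Lemma orbit_sumC O O' : orbit_sum O *m orbit_sum O' = orbit_sum O' *m orbit_sum O.
Proof.
have prodE A B : orbit_sum B *m orbit_sum A =
    \sum_v (\sum_(u | (orb u == A) && (orb (v - u) == B)) chi u v) *: heis v.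
  under [RHS]eq_bigr do rewrite scaler_suml; rewrite (exchange_big_dep (fun u => orb u == A)) /=.
    rewrite /orbit_sum mulmx_sumr; apply: eq_bigr => u uA.
    rewrite mulmx_suml uA /= [RHS](reindex_inj (addrI u)) /=.
    apply: eq_big => [w|w _]; first by rewrite addrC addKr.
    by rewrite heisM chiDr chi_diag mul1r.
  by move=> v u _ /andP[].
rewrite (prodE O' O) (prodE O O'); apply: eq_bigr => v _; congr (_ *: _).
have [r r_inj [rD rv rO rchi]] := reversing v.
rewrite [LHS](reindex_inj r_inj) [RHS](reindex_inj (subrI v)) /=.
have rB u : v - r u = r (v - u).
  by apply/eqP; rewrite subr_eq -rD subrK rv.
apply: eq_big => [u|u _]; last by rewrite rchi chiBl chi_diag mul1r.
by rewrite rB !(orb_eq (rO _)) opprB addrCA subrr addr0 andbC.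
Qed.

End Operators.

Lemma num_irr_constituents_orbits :
  num_irr_constituents rG = #|orbit 'P G @: [set: V]|.
Proof.
have [idx idxP] := transversal_idx.
rewrite (@num_irr_constituents_commutant C _ G _ rG _ _ (@orbit_sum idx)).
- by rewrite card_sig; apply: eq_card => O; rewrite inE.
- by rewrite /pgroup; apply/pnatP => // p _ _; rewrite inE /= char0.
- exact: orbit_sum_cent.
- exact: orbit_sumC.
- move=> c; rewrite orbit_sum_comb => /(heis_free idxP) c0 [O OP].
  by case/imsetP: (OP) => v _ Ov; rewrite -(c0 v); congr c; apply: val_inj.
- exact: cent_orbit_sum.
Qed.

End WeilCommutant.

(** * Orbit counting *)

Section BaseRing.
Variables (R : finComUnitRingType) (x : R) (m : {set R}) (l p : nat).
Hypothesis p_odd : odd p.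
Hypothesis p_char : p \in [pchar R].
Hypothesis m_gen : m = principal_ideal x.
Hypothesis l_ge1 : (1 <= l)%N.
Hypothesis m_nil : nilpotency_degree m l.
Variables (F : finFieldType) (pi : {rmorphism R -> F}).
Hypothesis pi_surj : forall c, exists r, pi r = c.
Hypothesis pi_ker : forall r, (pi r = 0) <-> (r \in m).

Lemma residue_ker r : pi r = 0 <-> exists s, r = x * s.
Proof.
rewrite pi_ker m_gen; split=> [/imsetP[s _ ->]|[s ->]]; first by exists s; rewrite mulrC.
by apply/imsetP; exists s; rewrite // mulrC.
Qed.

Lemma base_chain_ring : chain_ring x l.
Proof.
have xl := generator_expn m_gen m_nil.
split => //.
- apply/eqP => xl1; case: m_nil => _ /(_ l.-1); rewrite prednK // leqnn => /(_ isT); apply.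
  move=> f fm; have [g gE] : exists g, forall i, f i = g i * x.
    suff /fin_all_exists H i : exists s, f i = s * x by [].
    by move: (fm i); rewrite m_gen => /imsetP[s _ ->]; exists s.
  by under eq_bigr do rewrite gE; rewrite big_split /= prodr_const card_ord xl1 mulr0.
- move=> r nr; apply/residue_ker/eqP; apply: contraR nr => pr.
  have [s sE] := pi_surj (pi r)^-1.
  have [t tE] : exists t, r * s - 1 = x * t.
    by apply/residue_ker; rewrite rmorphB rmorphM sE rmorph1 divff ?subrr.
  have : r * s \is a GRing.unit.
    rewrite -[r * s](subrK 1) tE addrC; apply/unitrP.
    (* Geometric series for the inverse of 1 + x t, with x t nilpotent. *)
    exists (\sum_(i < l) (- (x * t)) ^+ i).
    have := subrX1 (- (x * t)) l; rewrite -mulrN exprMn xl mul0r sub0r.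
    move/(canRL opprK); rewrite -mulNr opprB mulrN opprK => e.
    by split; rewrite [RHS]e // mulrC.
  by rewrite unitrM => /andP[].
(* As p = 2 (p - 1)/2 + 1 vanishes in R, the inverse of 2 is -(p - 1)/2. *)
have pE := odd_double_half p; rewrite p_odd add1n in pE.
have := pcharf0 p_char; rewrite -pE -addn1 natrD -mul2n natrM => /eqP.
rewrite addr_eq0 => /eqP e; apply/unitrP; exists (- (p./2)%:R).
by split; [rewrite mulNr mulrC|rewrite mulrN]; rewrite e opprK.
Qed.

End BaseRing.

(** The values of g over a fibre of f form a singleton, which gives the bijection without choosing
    preimages. *)
Lemma card_imset_same_fibers (T S S' : finType) (f : T -> S) (g : T -> S') (D : {set T}) :
  (forall u v, f u = f v <-> g u = g v) -> #|f @: D| = #|g @: D|.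
Proof.
move=> fg; pose phi a := [set g v | v : T & (v \in D) && (f v == a)].
have phiE v : v \in D -> phi (f v) = [set g v].
  move=> vD; apply/setP => b; rewrite in_set1; apply/imsetP/eqP => [[w]|->].
    by rewrite inE => /andP[_ /eqP/fg <-] ->.
  by exists v; rewrite // inE vD eqxx.
rewrite -(card_in_imset (f := phi)); last first.
  move=> _ _ /imsetP[u uD ->] /imsetP[v vD ->]; rewrite !phiE //.
  by move/set1_inj/fg.
rewrite -[RHS](card_imset _ (@set1_inj S')) -!imset_comp.
by congr (#|pred_of_set _|); apply: eq_in_imset => v vD /=; rewrite phiE.
Qed.

(** * Hermitian modules over the quotient ring A *)

Section Ramified.
Variables (R : finComUnitRingType) (x : R).
Local Notation A := (ramified x).
Local Notation y := (ramified_y x).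

Lemma ramified_ext_qpoly :
  ramified_ext x (in_alg A) y (@star R x) (fun a : A => a`_0) (fun a : A => a`_1).
Proof.
split.
- exact: qX_sqr.
- by move=> a; rewrite mulr_algl; apply: ramifiedE.
- by move=> r s; rewrite mulr_algl (coef_pair x r s).
- by move=> r s; rewrite mulr_algl (coef_pair x r s).
- by move=> r s; rewrite mulr_algl; apply: starE.
Qed.


Variable V : finLmodType A.
Variables (h : V -> V -> A) (l n : nat).
Hypothesis xl : chain_ring x l.
Hypothesis h_herm : is_hermitian h.
Hypothesis h_nondeg : is_nondegenerate h.
Hypothesis n_ge1 : (1 <= n)%N.
Hypothesis V_free : free_of_rank V n.

Let ext := ramified_ext_qpoly.
Let hDl : forall u u' v, h (u + u') v = h u v + h u' v.
Proof. by case: h_herm. Qed.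
Let hDr : forall u v v', h u (v + v') = h u v + h u v'.
Proof. by case: h_herm. Qed.
Let hZr : forall a u v, h u (a *: v) = a * h u v.
Proof. by case: h_herm. Qed.
Let hS : forall u v, h v u = star (h u v).
Proof. by case: h_herm. Qed.

Lemma nondegenerate_inj v : (forall u, h v u = 0) -> v = 0.
Proof.
move=> hv; have [w [_ wU]] := h_nondeg (\0 : {scalar V}).
have -> : v = w by apply/esym/wU => u; rewrite hv.
by apply: wU => u; rewrite (h0l ext hZr hS).
Qed.

Lemma basis_inj k (b : 'I_k -> V) (c : 'I_k -> A) :
  is_basis b -> \sum_i c i *: b i = 0 -> forall i, c i = 0.
Proof.
move=> bB c0 i; have [d [_ dU]] := bB 0.
have <- : d i = c i.
  by rewrite (dU (finfun c)) ?ffunE //; under eq_bigr do rewrite ffunE.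
rewrite (dU [ffun=> 0]) ?ffunE //.
by rewrite big1 // => j _; rewrite ffunE scale0r.
Qed.

Lemma ann_free k (v : V) : (k <= l.*2)%N -> y ^+ k *: v = 0 ->
  exists w, v = y ^+ (l.*2 - k) *: w.
Proof.
move=> kl; have [b bB] := V_free; have [c [-> _]] := bB v.
rewrite scaler_sumr; under eq_bigr do rewrite scalerA.
move=> /(basis_inj bB) yc.
have [d dE] : exists d : 'I_n -> A, forall i, c i = y ^+ (l.*2 - k) * d i.
  suff /fin_all_exists H i : exists d, c i = y ^+ (l.*2 - k) * d by [].
  exact: (ann_yX xl ext kl (yc i)).
exists (\sum_i d i *: b i); rewrite scaler_sumr.
by apply: eq_bigr => i _; rewrite scalerA dE.
Qed.

Lemma free_nontriv : exists v : V, v != 0.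
Proof.
have [b bB] := V_free; pose i0 := Ordinal n_ge1; exists (b i0).
apply/eqP => b0; have /(basis_inj bB)/(_ i0)/eqP : \sum_i (i == i0)%:R *: b i = 0.
  by rewrite (bigD1 i0) //= b0 scaler0 add0r big1 // => i /negPf ->; rewrite scale0r.
by rewrite eqxx oner_eq0.
Qed.

Lemma card_free : #|V| = (#|A| ^ n)%N.
Proof.
have [b bB] := V_free.
rewrite -[n in RHS]card_ord -card_ffun; symmetry.
pose f (c : {ffun 'I_n -> A}) := \sum_i c i *: b i.
have fI : injective f.
  move=> c d; rewrite /f => cd; have [e [_ eU]] := bB (f c).
  by rewrite -(eU c erefl) (eU d).
rewrite -(card_imset _ fI) -cardsT; apply: eq_card => v; rewrite !inE.
by have [c [-> _]] := bB v; apply: imset_f.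
Qed.

(** By counting: k coefficients in A reach all |A|^n vectors. *)
Lemma frame_rank k (b : 'I_k -> V) :
  frame (in_alg A) (fun a : A => a`_0) h b -> (n <= k)%N.
Proof.
move=> [_ _ bE]; have A1 : (1 < #|A|)%N.
  by apply/card_gt1P; exists (0 : A), (1 : A); rewrite eq_sym oner_eq0.
rewrite -(leq_exp2l _ _ A1) -card_free -[k]card_ord -card_ffun.
rewrite -[in X in (_ <= X)%N]cardsT.
apply: leq_trans (leq_imset_card (fun c : {ffun 'I_k -> A} => \sum_i c i *: b i) _).
rewrite -cardsT; apply/subset_leq_card/subsetP => v _; apply/imsetP.
exists [ffun i => in_alg A (norm (fun a : A => a`_0) h (b i))^-1 * h (b i) v]; rewrite ?inE //.
by rewrite {1}(bE v); apply: eq_bigr => i _; rewrite ffunE.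
Qed.

Lemma orbit_conjugate u v :
  orbit 'P (unitary_group h) u = orbit 'P (unitary_group h) v <-> isoconj h u v.
Proof.
split=> [uv|[g /unitaryP gU <-]]; last exact/esym/(orbit_act 'P u).
have /orbitP[g /unitaryP gU gu] : v \in orbit 'P (unitary_group h) u.
  by rewrite uv orbit_refl.
by exists g.
Qed.

Local Notation prim_norms := (primitive_norms (fun a : A => a`_0) h).

Lemma num_unitary_orbitsE : num_unitary_orbits h =
  (2 * (\sum_(j < l) #|[set (x ^+ j * s)%R | s in prim_norms]|) + 1)%N.
Proof.
rewrite -(card_orbit_invariant xl ext hDl hDr hZr hS nondegenerate_inj ann_free free_nontriv).
apply: card_imset_same_fibers => u v; rewrite orbit_conjugate.
exact: conjugate_invariant.
Qed.

(** The map (t, t') |-> t + y^l t' is injective on pairs from T: the sum determines t modulo y^l V,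
    and then t' modulo the kernel of y^l, which is again y^l V. *)
Lemma card_transversal (T : {set V}) :
  is_transversal_mod l T -> (#|T| * #|T| <= #|V|)%N.
Proof.
move=> Ttr; rewrite -cardsX.
have iV_subr v w : y ^+ l *: (v - w) \in iV V l.
  by apply/iVP; exists (v - w).
have T_inj t t' : t \in T -> t' \in T -> t - t' \in iV V l -> t = t'.
  move=> tT t'T tt'; have [s [_ sU]] := Ttr t.
  rewrite -(sU t') // -(sU t) //; split=> //; apply/iVP; exists 0.
  by rewrite subrr scaler0.
pose f (tt : V * V) := tt.1 + y ^+ l *: tt.2.
rewrite -(card_in_imset (f := f)) ?max_card // => -[t t'] [s s'] /setXP[tT t'T] /setXP[sT s'T].
rewrite /f /= => e.
have swap (Z : zmodType) (a b c d : Z) : a + b = c + d -> a - c = d - b.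
  by move=> abcd; apply/eqP; rewrite subr_eq addrAC eq_sym subr_eq [d + c]addrC abcd.
have ts : t = s.
  apply: T_inj => //; have -> : t - s = y ^+ l *: (s' - t'); last exact: iV_subr.
  by rewrite scalerBr; apply: swap.
congr (_, _) => //; apply: T_inj => //; move: e; rewrite ts => /addrI/eqP.
rewrite -subr_eq0 -scalerBr => /eqP/(@ann_free l).
rewrite -addnn leq_addr addnK => /(_ isT)[w ->].
by apply/iVP; exists w.
Qed.

(** * The pairing mu (h u v) and the Weil module *)

Section Character.
Variables (C : closedFieldType) (lam : R -> C).
Hypothesis lam_char : linear_char lam.
Hypothesis lam_prim : is_primitive lam.
Local Notation chi u v := (lam (dmap (h u v))).

Lemma linear_char0 : lam 0 = 1.
Proof.
by have [lam0 lamD] := lam_char; apply: (mulfI (lam0 0)); rewrite mulr1 -lamD addr0.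
Qed.

Lemma primitive_ideal (c : R) : (forall r, lam (r * c) = 1) -> c = 0.
Proof.
move=> lamc; have cI : c \in principal_ideal c by apply/imsetP; exists 1; rewrite ?mul1r.
apply/set1P; rewrite -(lam_prim (I := principal_ideal c)) //.
  split; first by apply/imsetP; exists 0; rewrite ?mul0r.
  move=> a _ _ /imsetP[r _ ->] /imsetP[s _ ->]; apply/imsetP.
  by exists (a * r + s); rewrite // mulrDl mulrA.
by move=> _ /imsetP[r _ ->].
Qed.

Lemma dmap_star_opp (a : A) : dmap (star a) = - dmap a.
Proof. by rewrite /dmap (im_star ext) mulNrn. Qed.

(** The 4 combines the 2 in [dmap] with the square. Replacing w by (r / 4) y w and by (r / 4) w
    shows that lam is trivial on the ideals generated by re a and im a, which therefore vanish. *)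
Lemma pairing_nondegenerate u : (forall w, chi u w ^+ 2 = 1) -> u = 0.
Proof.
move=> chi1; apply: nondegenerate_inj => w; set a := h u w.
have [_ lamD] := lam_char; have u2 := chain_unit2 xl.
have lam_im (b : A) : lam (4 * (b * a)`_1) = 1.
  by have := chi1 (b *: w); rewrite hZr expr2 -lamD -/a /dmap => <-; congr lam; ring.
have quarter (r : R) : r = 4 * (r / 2 / 2).
  rewrite (_ : 4 = 2 * 2 :> R); last by ring.
  by rewrite mulrC mulrA !divrK.
apply: (reim_eq ext); rewrite /= coef0; apply: primitive_ideal => r.
  have := lam_im (in_alg A (r / 2 / 2) * y).
  rewrite !(imM ext) (reM ext) (re_io ext) (im_io ext) (re_y ext) (im_y ext).
  by rewrite !(mulr0, mul0r, add0r, addr0, mulr1) mulrA -quarter.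
have := lam_im (in_alg A (r / 2 / 2)).
by rewrite (imM ext) (re_io ext) (im_io ext) mul0r addr0 mulrA -quarter.
Qed.

Hypothesis char0 : [pchar C] =i pred0.
Variables (m : {set R}) (T : {set V}).
Hypothesis m_gen : m = principal_ideal x.
Hypothesis m_nil : nilpotency_degree m l.
Hypothesis T_trans : is_transversal_mod l T.

Lemma weil_constituents :
  num_irr_constituents (weil_repr m_gen m_nil h_herm lam_char T_trans) =
  num_unitary_orbits h.
Proof.
have [lam0 lamD] := lam_char.
have chi_diag v : chi v v = 1 by rewrite dmap_star ?linear_char0 // -hS.
have chiV u v : chi u v * chi v u = 1.
  by rewrite -lamD [h v u]hS dmap_star_opp subrr linear_char0.
apply: (@num_irr_constituents_orbits V C (fun u v => chi u v) char0 _ _ chiV chi_diag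
  pairing_nondegenerate (iV V l) T) => //.
- by move=> u u' v; rewrite hDl dmapD lamD.
- by move=> u v v'; rewrite hDr dmapD lamD.
- by move=> z z' /iVP[w ->] /iVP[w' ->]; apply/iVP; exists (w + w'); rewrite scalerDr.
- by move=> z /iVP[w ->]; apply/iVP; exists (- w); rewrite scalerN.
- move=> z z' /iVP[w ->] /iVP[w' ->]; rewrite (hZl ext hZr hS) hZr.
  rewrite (starX ext) (star_y ext) exprNn -!mulrA [y ^+ l * (y ^+ l * _)]mulrA -exprD addnn.
  by rewrite (y_nil xl ext) mul0r mulr0 dmap0 linear_char0.
- exact: card_transversal.
- by move=> g /unitaryP[].
- by move=> g /unitaryP[_ _ gh] u v; rewrite gh.
- move=> g /unitaryP[_ gZ _] z /iVP[w ->]; rewrite gZ; apply/iVP; by exists (g w).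
- by move=> g i j _; rewrite /= mxE.
move=> v; have [r r_inj [rD rv rU rh]] :=
  orbit_reversing xl ext hDl hDr hZr hS nondegenerate_inj ann_free free_nontriv v.
exists r => //; split=> // [u|u]; first by apply/orbit_conjugate/conjugate_sym.
by rewrite rh -hS.
Qed.

End Character.

(** * Evaluation of the orbit count *)

Section OrbitCount.
Variables (F : finFieldType) (pi : {rmorphism R -> F}).
Hypothesis pi_surj : forall c : F, exists r, pi r = c.
Hypothesis pi_ker : forall r, pi r = 0 <-> exists s, r = x * s.
Local Notation q := #|F|.

Lemma telescope_powers k :
  (\sum_(j < k) (q ^ (k - j) - q ^ (k - j.+1)) + 1 = q ^ k)%N.
Proof.
have q0 : (0 < q)%N by apply/card_gt0P; exists 0.
elim: k => [|k IH]; first by rewrite big_ord0.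
rewrite big_ord_recl subn0 subn1 /= -addnA.
under eq_bigr => j _ do rewrite /bump /= add1n !subSS.
by rewrite IH subnK // leq_pexp2l.
Qed.

Lemma num_orbits_universal : prim_norms = setT ->
  num_unitary_orbits h = (2 * (\sum_(1 <= i < l.+1) q ^ i) + 1)%N.
Proof.
move=> norms; rewrite num_unitary_orbitsE norms; congr (2 * _ + 1)%N.
rewrite big_add1 /= big_mkord [RHS](reindex_inj rev_ord_inj) /=.
apply: eq_bigr => j _; have jl := ltn_ord j.
have -> : #|[set x ^+ j * s | s in [set: R]]| = #|[set x ^+ j * s | s : R]|.
  by apply: eq_card => r; apply/imsetP/imsetP => -[s _ ->]; exists s.
by rewrite (card_expx_ideal xl pi_surj pi_ker (ltnW jl)) -subSn // subSS.
Qed.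

Lemma num_orbits_units : prim_norms = [set u | u \is a GRing.unit] ->
  num_unitary_orbits h = (2 * q ^ l - 1)%N.
Proof.
move=> norms; rewrite num_unitary_orbitsE norms.
rewrite -(telescope_powers l) mulnDr -addnBA //; congr (2 * _ + _)%N.
apply: eq_bigr => j _; rewrite -(card_expx_units xl pi_surj pi_ker (ltn_ord j)).
by apply: eq_card => r; apply/imsetP/imsetP => -[s /[!inE] us ->]; exists s; rewrite ?inE.
Qed.

(** In each layer the factor 2 compensates for squares being half of the units, and the sum
    telescopes to q^l - 1. *)
Lemma num_orbits_squares (c : R) : c \is a GRing.unit ->
  prim_norms = [set c * u ^+ 2 | u : R & u \is a GRing.unit] ->
  num_unitary_orbits h = (q ^ l)%N.
Proof.
move=> uc norms; rewrite num_unitary_orbitsE norms -(telescope_powers l); congr (_ + 1)%N.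
rewrite big_distrr /=; apply: eq_bigr => j _.
rewrite -(card_expx_squares xl pi_surj pi_ker (ltn_ord j) uc) mulnC; congr (_ * 2)%N.
by rewrite -imset_comp.
Qed.

End OrbitCount.

End Ramified.

Theorem theorem9p5
  (R : finComUnitRingType) (p : nat) (p_odd : odd p) (p_char : p \in [pchar R])
  (m : {set R}) (R_local : is_local_with m) (R_principal : is_principal_ring R)
  (l : nat) (l_ge1 : (1 <= l)%N) (m_nil : nilpotency_degree m l)
  (F : finFieldType) (pi : {rmorphism R -> F})
  (pi_surj : forall c, exists r, pi r = c)
  (pi_ker : forall r, (pi r = 0) <-> (r \in m))
  (x : R) (m_gen : m = principal_ideal x)
  (V : finLmodType (ramified x)) (n : nat) (n_ge1 : (1 <= n)%N)
  (V_free : free_of_rank V n)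
  (h : V -> V -> ramified x) (h_herm : is_hermitian h) (h_nondeg : is_nondegenerate h)
  (RR : realType) (lam : R -> RR[i]) (lam_char : linear_char lam)
  (lam_prim : is_primitive lam)
  (T : {set V}) (T_trans : is_transversal_mod l T)
  (eps : R) (eps_unit : eps \is a GRing.unit)
  (eps_nonsq : ~ exists2 r : R, r \is a GRing.unit & eps = r ^+ 2) :
  let q := #|F| in
  let X := weil_repr m_gen m_nil h_herm lam_char T_trans in
  [/\ num_irr_constituents X = num_unitary_orbits h,
      n = 1%N -> num_unitary_orbits h = (q ^ l)%N,
      n = 2%N -> of_type h [tuple 1; - eps] ->
        num_unitary_orbits h = (2 * q ^ l - 1)%N &
      (2 < n)%N \/ (n = 2%N /\ of_type h [tuple 1; -1]) ->
        num_unitary_orbits h = (2 * (\sum_(1 <= i < l.+1) q ^ i) + 1)%N].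
Proof.
move=> q X.
have xl := base_chain_ring p_odd p_char m_gen l_ge1 m_nil pi_surj pi_ker.
have xker := residue_ker m_gen pi_ker.
have ext := ramified_ext_qpoly x.
have [hDl hDr hZr hS] := h_herm.
have h_inj := nondegenerate_inj h_herm h_nondeg.
have ann := ann_free xl V_free.
have nontriv := free_nontriv n_ge1 V_free.
have norm_type k (r : k.-tuple R) (b : 'I_k -> V) :
    (forall i j, h (b i) (b j) = if i == j then (tnth r i)%:A else 0) ->
    forall i, norm (fun a : ramified x => a`_0) h (b i) = tnth r i.
  by move=> hb i; rewrite /norm hb eqxx -[_%:A]/(in_alg _ _) (re_io ext).
split.
- have char0 : [pchar RR[i]] =i pred0 by exact: Num.Theory.pchar_num.
  exact: (weil_constituents xl h_herm h_nondeg n_ge1 V_free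
    lam_char lam_prim char0 m_gen m_nil T_trans).
- move=> n1; subst n; have [b bB] := V_free.
  have bE v : exists c, v = c *: b ord0.
    by have [c [-> _]] := bB v; exists (c ord0); rewrite big_ord1.
  have [c uc norms] := norms_rank1 xl ext hZr hS h_inj ann nontriv bE.
  exact: (num_orbits_squares xl h_herm h_nondeg n_ge1 V_free pi_surj xker uc norms).
- move=> n2 [b [bB hb]].
  apply: (num_orbits_units xl h_herm h_nondeg n_ge1 V_free pi_surj xker).
  apply: (norms_anisotropic xl ext hDl hDr hZr hS pi_surj xker
    (b := b) (eps := eps) _ _ _ _ eps_unit eps_nonsq).
  + by move=> v; have [c [-> _]] := bB v; exists c.
  + by rewrite hb.
  + by rewrite (norm_type _ _ _ hb).
  + by rewrite (norm_type _ _ _ hb).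
case=> [n3|[n2 [b [bB hb]]]];
    apply: (num_orbits_universal xl h_herm h_nondeg n_ge1 V_free pi_surj xker).
(* An orthogonal basis has at least n > 2 members; three of them suffice. *)
- have [k [b bF]] := frame_exists xl ext hDl hDr hZr hS h_inj ann nontriv.
  have kn := leq_trans n3 (frame_rank V_free bF).
  have [b_orth b_unit _] := bF.
  pose i0 := Ordinal (ltnW (ltnW kn)); pose i1 := Ordinal (ltnW kn); pose i2 := Ordinal kn.
  exact: (norms_universal3 xl ext hDl hDr hZr hS pi_surj xker
    (b_orth i0 i1 isT) (b_orth i0 i2 isT) (b_orth i1 i2 isT)).
apply: (norms_hyperbolic xl ext hDl hDr hZr hS (u := b ord0) (w := b ord_max)).
+ by rewrite hb.
+ by rewrite (norm_type _ _ _ hb).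
+ by rewrite (norm_type _ _ _ hb).
Qed.
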